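(* Let $X\subseteq\mathbb{A}^{n+1}$ be the affine cone over a smooth projective variety $Y\subseteq\mathbb{P}^n$. If $Y$ is not birationally ruled, then $\operatorname{Aut}(X)=\operatorname{Lin}(X)$. Moreover, $\operatorname{Aut}(X)$ is a central extension of the group $\operatorname{Lin}(Y)$ by $\mathbb{C}^*$.
   Context: All varieties are defined over $\mathbb{C}$. The affine cone over a projective variety $Y\subseteq\mathbb{P}^n$ is the closed subvariety of $\mathbb{A}^{n+1}$ defined by the homogeneous ideal of $Y$. A projective variety is birationally ruled if it is birationally equivalent to a product $Z\times\mathbb{P}^1$. $\operatorname{Aut}(X)$ is the group of biregular automorphisms of $X$. $\operatorname{Lin}(X)$ (for $X\subseteq\mathbb{A}^{n+1}$) is the group of automorphisms of $X$ which extend to linear automorphisms of $\mathbb{A}^{n+1}$, and $\operatorname{Lin}(Y)$ (for $Y\subseteq\mathbb{P}^n$) is the group of automorphisms of $Y$ which extend to projective linear transformations of $\mathbb{P}^n$. The subgroup $\mathbb{C}^*$ acts on $X$ by scalar matrices.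
   Formalization: Y is assumed to have at least two points: if Y is a single point, it is smooth and not birationally ruled, but X is an affine line and x ↦ x+1 is a non-linear automorphism, so the claim fails there. *)

(* Defs.v *)
From HB Require Import structures.
From mathcomp Require Import all_boot all_algebra.
From mathcomp Require Import boolp classical_sets reals.
From mathcomp Require Import complex mpoly.

Set Implicit Arguments.
Unset Strict Implicit.
Unset Printing Implicit Defensive.

Import GRing.Theory.

Local Open Scope ring_scope.
Local Open Scope classical_set_scope.

Section Projective.
Variable K : closedFieldType.

(* Projective space with N homogeneous coordinates, i.e. P^(N-1): the lines
   through the origin of K^N. *)
Definition pspace (N : nat) := {U : {vspace 'rV[K]_N} | \dim U == 1%N}.

(* x is a vector of homogeneous coordinates of P; as P has dimension 1, this
   forces x != 0. *)
Definition coords N (P : pspace N) (x : 'rV[K]_N) : Prop :=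
  val P = <[x]>%VS.

Definition vanishes N (F : {mpoly K[N]}) (P : pspace N) : Prop :=
  forall x, coords P x -> F.@[x 0] = 0.

Definition pclosed N (Z : set (pspace N)) : Prop :=
  exists S : set {mpoly K[N]},
    (forall F, S F -> F \is homog mdeg) /\
    (forall P, Z P <-> forall F, S F -> vanishes F P).

Definition irreducible_set N (Z : set (pspace N)) : Prop :=
  Z !=set0 /\
  forall Z1 Z2, pclosed Z1 -> pclosed Z2 ->
    Z `<=` Z1 `|` Z2 -> Z `<=` Z1 \/ Z `<=` Z2.

Definition projective_variety N (Y : set (pspace N)) : Prop :=
  pclosed Y /\ irreducible_set Y.

Definition has_chain N (Y : set (pspace N)) (d : nat) : Prop :=
  exists Z : nat -> set (pspace N),
    (forall i, (i <= d)%N -> projective_variety (Z i) /\ Z i `<=` Y) /\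
    (forall i, (i < d)%N -> Z i `<` Z i.+1).

(* Krull dimension of the Zariski topology *)
Definition has_dim N (Y : set (pspace N)) (d : nat) : Prop :=
  has_chain Y d /\ forall e, has_chain Y e -> (e <= d)%N.

Definition homogeneous_ideal N (Y : set (pspace N)) : set {mpoly K[N]} :=
  [set p | exists (k : nat) (a F : 'I_k -> {mpoly K[N]}),
      (forall i, F i \is homog mdeg /\ forall P, Y P -> vanishes (F i) P) /\
      p = \sum_(i < k) a i * F i].

Definition affine_cone N (Y : set (pspace N)) : set 'rV[K]_N :=
  [set x | forall p, homogeneous_ideal Y p -> p.@[x 0] = 0].

(* The linear subspace of K^N underlying the embedded projective tangent space
   of Y at P. *)
Definition tangent N (Y : set (pspace N)) (P : pspace N) : set 'rV[K]_N :=
  [set v | forall p x, homogeneous_ideal Y p -> coords P x ->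
      \sum_(i < N) (p^`M(i)).@[x 0] * v 0 i = 0].

(* At every point the projective tangent space has the dimension d of Y, that
   is, the underlying linear subspace has dimension d + 1. *)
Definition smooth N (Y : set (pspace N)) : Prop :=
  exists d, has_dim Y d /\
    forall P, Y P -> exists T : {vspace 'rV[K]_N},
      \dim T = d.+1 /\ forall v, v \in T <-> tangent Y P v.

(* Maps given, locally for the Zariski topology, by forms of equal degree; the
   condition on coords forces these forms not to vanish simultaneously. *)
Definition pregular N M (U : set (pspace N)) (f : U -> pspace M) : Prop :=
  forall P : U, exists (H : {mpoly K[N]}) (d : nat) (F : 'I_M -> {mpoly K[N]}),
    [/\ H \is homog mdeg, ~ vanishes H (val P), forall j, F j \is d.-homog
      & forall (Q : U) x, ~ vanishes H (val Q) -> coords (val Q) x ->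
          coords (f Q) (\row_j (F j).@[x 0])].

Definition isomorphic N M (U : set (pspace N)) (V : set (pspace M)) : Prop :=
  exists (f : U -> V) (g : V -> U),
    [/\ cancel f g, cancel g f, pregular (fun P => val (f P))
      & pregular (fun Q => val (g Q))].

Definition open_in N (Y U : set (pspace N)) : Prop :=
  exists Z, pclosed Z /\ U = Y `\` Z.

Definition birational N M (Y : set (pspace N)) (W : set (pspace M)) : Prop :=
  exists (U : set (pspace N)) (V : set (pspace M)),
    [/\ open_in Y U, U !=set0, open_in W V, V !=set0 & isomorphic U V].

(* The product, as a projective variety via the Segre embedding
   ([a], [b]) |-> [a_i * b_j]. *)
Definition segre_product M N (Z : set (pspace M)) (W : set (pspace N)) :
    set (pspace (M * N)) :=
  [set P | exists A B, [/\ Z A, W B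
     & forall a b, coords A a -> coords B b -> coords P (mxvec (a^T *m b))]].

Definition birationally_ruled N (Y : set (pspace N)) : Prop :=
  exists (m : nat) (Z : set (pspace m.+1)),
    projective_variety Z /\ birational Y (segre_product Z [set: pspace 2]).

Definition aregular N M (X : set 'rV[K]_N) (f : X -> 'rV[K]_M) : Prop :=
  exists F : 'I_M -> {mpoly K[N]},
    forall x : X, f x = \row_j (F j).@[(val x) 0].

End Projective.

Record mapClass (T : Type) := MapClass {
  inClass :> (T -> T) -> Prop;
  inClass_id : inClass id;
  inClass_comp : forall f g, inClass f -> inClass g -> inClass (f \o g)
}.

Section AutomorphismGroup.
Variables (T : Type) (C : mapClass T).

Record aut := MkAut {
  aut_fun :> T -> T;
  aut_inv : T -> T;
  aut_funK : cancel aut_fun aut_inv;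
  aut_invK : cancel aut_inv aut_fun;
  aut_funP : C aut_fun;
  aut_invP : C aut_inv
}.

Lemma aut_ext (f g : aut) : f =1 g -> f = g.
Proof.
case: f g => f f' fK f'K Cf Cf' [g g' gK g'K Cg Cg'] /= fg.
have efg : f = g by apply: funext.
subst g.
have efg' : f' = g' by apply: funext => x; rewrite -{1}(g'K x) fK.
subst g'.
by congr MkAut; apply: Prop_irrelevance.
Qed.

Definition aut1 : aut :=
  @MkAut id id (fun=> erefl) (fun=> erefl) (inClass_id C) (inClass_id C).

Definition autV (f : aut) : aut :=
  MkAut (aut_invK f) (aut_funK f) (aut_invP f) (aut_funP f).

Definition autM (f g : aut) : aut :=
  MkAut (can_comp (aut_funK f) (aut_funK g))
        (can_comp (aut_invK g) (aut_invK f))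
        (inClass_comp (aut_funP f) (aut_funP g))
        (inClass_comp (aut_invP g) (aut_invP f)).

Lemma autMA : associative autM. Proof. by move=> f g h; apply: aut_ext. Qed.
Lemma aut1M : left_id aut1 autM. Proof. by move=> f; apply: aut_ext. Qed.
Lemma autM1 : right_id aut1 autM. Proof. by move=> f; apply: aut_ext. Qed.
Lemma autVM : left_inverse aut1 autV autM.
Proof. by move=> f; apply: aut_ext => x /=; apply: aut_funK. Qed.
Lemma autMV : right_inverse aut1 autV autM.
Proof. by move=> f; apply: aut_ext => x /=; apply: aut_invK. Qed.

HB.instance Definition _ := gen_eqMixin aut.
HB.instance Definition _ := gen_choiceMixin aut.
HB.instance Definition _ := isGroup.Build aut autMA aut1M autM1 autVM autMV.

End AutomorphismGroup.

Section Composition.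
Variable K : closedFieldType.

Lemma aregular_id N (X : set 'rV[K]_N) : aregular (fun x : X => val x).
Proof.
exists (fun j => 'X_j) => x; apply/rowP => j.
by rewrite mxE mevalXU.
Qed.

Lemma aregular_comp N (X : set 'rV[K]_N) (f g : X -> X) :
  aregular (fun x => val (f x)) -> aregular (fun x => val (g x)) ->
  aregular (fun x => val (f (g x))).
Proof.
move=> [F hF] [G hG]; exists (fun j => F j \mPo [tuple G i | i < N]) => x.
rewrite hF; apply/rowP => j; rewrite !mxE comp_mpoly_meval.
by apply: meval_eq => i; rewrite hG !mxE tnth_mktuple.
Qed.

Lemma homog_eval N d (F : {mpoly K[N]}) (c : K) (x : 'rV[K]_N) :
  F \is d.-homog -> F.@[(c *: x : 'rV_N) 0] = c ^+ d * F.@[x 0].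
Proof.
move=> /dhomogP hF; rewrite !mevalE mulr_sumr.
apply: eq_big_seq => m /hF <-; rewrite mulrCA; congr (_ * _).
rewrite /= mdegE -prodrXr -big_split /=.
by apply: eq_bigr => i _; rewrite mxE exprMn.
Qed.

Lemma homog_comp N M d e (H : {mpoly K[M]}) (F : 'I_M -> {mpoly K[N]}) :
  H \is e.-homog -> (forall j, F j \is d.-homog) ->
  H \mPo [tuple F i | i < M] \is (d * e).-homog.
Proof.
move=> /dhomogP hH hF; rewrite comp_mpolyE big_seq.
apply: rpred_sum => m /hH; rewrite /= mdegE => <-; apply: rpredZ.
rewrite big_distrr /=.
elim/big_ind2: _ => [|p a q b|i _]; first exact: dhomog1.
  exact: dhomogM.
by rewrite tnth_mktuple; apply: dhomogMn.
Qed.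

Lemma not_vanishes N (H : {mpoly K[N]}) P x :
  H \is homog mdeg -> coords P x -> ~ vanishes H P <-> H.@[x 0] != 0.
Proof.
move=> /homogP[d hH] Px; split=> [nH|Hx]; last by move=> /(_ x Px)/eqP; apply/negP.
apply/negP => /eqP Hx0; apply: nH => y Py.
have : y \in <[x]>%VS by rewrite -Px Py memv_line.
by move=> /vlineP[c ->]; rewrite (homog_eval _ _ hH) Hx0 mulr0.
Qed.

Lemma coords_ex N (P : pspace K N) : exists x, coords P x.
Proof.
case: P => U dU; rewrite /coords /=; exists (vpick U).
apply/eqP; rewrite eq_sym eqEdim -memvE memv_pick /= (eqP dU) dim_vline.
by rewrite vpick0 -dimv_eq0 (eqP dU).
Qed.

Lemma pregular_id N (Y : set (pspace K N)) : pregular (fun P : Y => val P).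
Proof.
move=> P; exists 1, 1%N, (fun j => 'X_j); split.
- by apply/homogP; exists 0%N; apply: dhomog1.
- have [x Px] := coords_ex (val P); move=> /(_ x Px); rewrite meval1.
  by apply/eqP; rewrite oner_eq0.
- by move=> j; rewrite dhomogX /= mdeg1.
- move=> Q x _; rewrite /coords => ->; congr <[_]>%VS.
  by apply/rowP => j; rewrite mxE mevalXU.
Qed.

Lemma pregular_comp N (Y : set (pspace K N)) (f g : Y -> Y) :
  pregular (fun P => val (f P)) -> pregular (fun P => val (g P)) ->
  pregular (fun P => val (f (g P))).
Proof.
move=> rf rg P; have [H1 [d [G [hH1 nH1 hG gG]]]] := rg P.
have [H2 [e [F [hH2 nH2 hF fF]]]] := rf (g P).
have ev (p : {mpoly K[N]}) x :
    (p \mPo [tuple G i | i < N]).@[x 0] = p.@[(\row_i (G i).@[x 0]) 0].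
  rewrite comp_mpoly_meval; apply: meval_eq => i.
  by rewrite mxE tnth_mktuple.
have hH : H1 * (H2 \mPo [tuple G i | i < N]) \is homog mdeg.
  have /homogP[a ha] := hH1; have /homogP[b hb] := hH2.
  by apply/homogP; exists (a + d * b)%N; apply: dhomogM => //; apply: homog_comp.
exists (H1 * (H2 \mPo [tuple G i | i < N])), (d * e)%N.
exists (fun j => F j \mPo [tuple G i | i < N]); split=> //.
- have [x Px] := coords_ex (val P); apply/(not_vanishes hH Px).
  rewrite mevalM ev mulf_neq0 //; first by apply/(not_vanishes hH1 Px).
  by apply: (iffLR (not_vanishes hH2 _)) nH2; apply: gG.
- by move=> j; apply: homog_comp.
- move=> Q x /[swap] Qx /(not_vanishes hH Qx).
  rewrite mevalM ev mulf_eq0 negb_or => /andP[H1x H2x].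
  have gQx : coords (val (g Q)) (\row_i (G i).@[x 0]).
    by apply: gG => //; apply/(not_vanishes hH1 Qx).
  have := fF (g Q) _ (iffRL (not_vanishes hH2 gQx) H2x) gQx.
  by congr coords; apply/rowP => j; rewrite !mxE ev.
Qed.

Definition affine_regular_maps N (X : set 'rV[K]_N) : mapClass X :=
  @MapClass X (fun f => aregular (fun x => val (f x)))
    (@aregular_id N X) (@aregular_comp N X).

Definition projective_regular_maps N (Y : set (pspace K N)) : mapClass Y :=
  @MapClass (set_type Y) (fun f => pregular (fun P => val (f P)))
    (@pregular_id N Y) (@pregular_comp N Y).

End Composition.

Section Groups.
Variable K : closedFieldType.

(* The group law on the groups of automorphisms is f * g = f \o g. *)
Definition affAut N (X : set 'rV[K]_N) := aut (affine_regular_maps X).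
HB.instance Definition _ N (X : set 'rV[K]_N) := Group.on (affAut X).

Definition affLin N (X : set 'rV[K]_N) : set (affAut X) :=
  [set f | exists A : 'M[K]_N, A \in unitmx /\
      forall x : X, val (f x) = val x *m A].

Definition projAut N (Y : set (pspace K N)) := aut (projective_regular_maps Y).
HB.instance Definition _ N (Y : set (pspace K N)) := Group.on (projAut Y).

Definition extends_linearly N (Y : set (pspace K N)) (f : projAut Y) : Prop :=
  exists A : 'M[K]_N, A \in unitmx /\
    forall (P : Y) x, coords (val P) x -> coords (val (f P)) (x *m A).

Definition projLin_pred N (Y : set (pspace K N)) : {pred projAut Y} :=
  [pred f | `[< extends_linearly f >]].
Arguments projLin_pred {N} Y f.

Lemma vlineZ N (c : K) (v : 'rV[K]_N) : c != 0 -> <[c *: v]>%VS = <[v]>%VS.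
Proof.
move=> c0; apply/eqP; rewrite eqEsubv -!memvE memvZ ?memv_line //=.
by rewrite -[X in X \in _](scalerK c0) memvZ ?memv_line.
Qed.

Lemma projLin_closed N (Y : set (pspace K N)) : group_closed (projLin_pred Y).
Proof.
split; first by apply/asboolP; exists 1%:M; split=> [|P x]; rewrite ?unitmx1 ?mulmx1.
move=> f g /asboolP[A [uA fA]] /asboolP[B [uB gB]]; apply/asboolP.
exists (invmx B *m A); split; first by rewrite unitmx_mul unitmx_inv uA uB.
move=> P x Px; rewrite mulmxA; apply: fA => /=.
have [y Qy] := coords_ex (val (aut_inv g P)).
have := gB _ _ Qy; rewrite aut_invK /coords Px => xy.
have /vlineP[c xE] : x \in <[y *m B]>%VS by rewrite -xy memv_line.
have c0 : c != 0.
  apply/eqP => c0; have := valP (val P); rewrite /= Px xE c0 scale0r.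
  by rewrite dim_vline eqxx.
by rewrite xE -scalemxAl mulmxK // Qy; rewrite (vlineZ _ c0).
Qed.

Definition projLin N (Y : set (pspace K N)) :=
  {f : projAut Y | f \in projLin_pred Y}.
HB.instance Definition _ N (Y : set (pspace K N)) :=
  SubChoice.on (projLin Y).
HB.instance Definition _ N (Y : set (pspace K N)) :=
  SubChoice_isSubGroup.Build (projAut Y) (projLin_pred Y) (projLin Y)
    (@projLin_closed N Y).

Definition Kstar := {c : K | c != 0}.
HB.instance Definition _ := Choice.on Kstar.

Definition Kstar1 : Kstar := exist _ 1 (oner_neq0 K).
Definition KstarM (a b : Kstar) : Kstar :=
  exist _ (val a * val b) (mulf_neq0 (valP a) (valP b)).
Definition KstarV (a : Kstar) : Kstar :=
  exist _ (val a)^-1 (invr_neq0 (valP a)).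

Lemma KstarMA : associative KstarM.
Proof. by move=> a b c; apply: val_inj; apply: mulrA. Qed.
Lemma Kstar1M : left_id Kstar1 KstarM.
Proof. by move=> a; apply: val_inj; apply: mul1r. Qed.
Lemma KstarM1 : right_id Kstar1 KstarM.
Proof. by move=> a; apply: val_inj; apply: mulr1. Qed.
Lemma KstarVM : left_inverse Kstar1 KstarV KstarM.
Proof. by move=> a; apply: val_inj; apply: mulVf (valP a). Qed.
Lemma KstarMV : right_inverse Kstar1 KstarV KstarM.
Proof. by move=> a; apply: val_inj; apply: mulfV (valP a). Qed.

HB.instance Definition _ :=
  isGroup.Build Kstar KstarMA Kstar1M KstarM1 KstarVM KstarMV.

End Groups.

Arguments affLin {K N} X f.

(* 1 -> A -> E -> G -> 1 is exact and the image of A is central in E. *)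
Definition central_extension (A E G : groupType) (i : A -> E) (p : E -> G) :
    Prop :=
  ({morph i : a b / (a * b)%g} /\ {morph p : e f / (e * f)%g}) /\
  [/\ injective i, forall g, exists e, p e = g,
      forall e, p e = 1%g <-> exists a, e = i a
    & forall a e, commute (i a) e].

(* Main.v *)
Require Import Defs.
From HB Require Import structures.
From mathcomp Require Import all_boot all_algebra.
From mathcomp Require Import boolp classical_sets reals.
From mathcomp Require Import complex mpoly.
From mathcomp Require Import ring zify.

Set Implicit Arguments.
Unset Strict Implicit.
Unset Printing Implicit Defensive.

Import GRing.Theory Num.Theory.

Local Open Scope ring_scope.
Local Open Scope classical_set_scope.

(** Conjugating the action of the multiplicative group on the cone X by
    scalars with an automorphism f of X gives a second such action. Its
    infinitesimal generator is a polynomial vector field v on X, and the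
    derivation p |-> v p of the coordinate ring is locally finite: it is
    diagonalizable, with the natural numbers as eigenvalues (lie_flow,
    iter_lie_flow). Decompose v into homogeneous parts.

    If a part of degree different from 1 survives on X, the extreme part on
    that side is a nonzero homogeneous locally nilpotent derivation D: for the
    top part, a power of D is the top-degree part of the corresponding power
    of v, whose values stay in bounded degree (flow_top_nilp); for the part of
    degree 0 the coefficients are constant (lie_const_nilp). Otherwise v is
    linear; then the homogeneous parts of each coordinate of f are eigenvectors
    of v of eigenvalue 1, and comparing orders of vanishing at the vertex kills
    all of them except the linear one (flow_linear). Thus f is linear unless
    such a D exists (ruling_or_linear).

    A homogeneous locally nilpotent D makes Y birationally ruled. Choose a
    homogeneous s with D s = a nonzero and D a = 0. After inverting a, the
    coordinate ring is a polynomial ring in s over ker D (slice_expand,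
    slice_indep). Passing to fractions of degree 0, the function field of Y is
    K0(u), where K0 comes from ker D and u = h2 s^nu / h1 for the least nu > 0
    admitting homogeneous h1, h2 in ker D with deg h1 = deg (h2 s^nu). Indeed
    two monomials c s^i and c' s^i' of the same degree then have nu | i - i'
    (period_dvd), so all coordinates of X are, up to one common factor,
    polynomials in u over K0 (ruling_of_slice). Geometrically, suitable forms
    in ker D map Y onto a dense subset of a variety Z, together with u they map
    Y to the product of Z and the projective line, and the polynomials in u
    give the inverse (ruling_isomorphic). Density of the image, which holds
    because u is transcendental over K0, turns every identity valid on the
    image into one valid on the whole product (bihomog_dense).

    So every automorphism of X is linear on X. On X it agrees with an
    invertible matrix (linear_unit_extension) and hence induces an element of
    Lin(Y). An automorphism inducing the identity on Y has every point of X as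
    an eigenvector, and irreducibility of Y forces a single eigenvalue
    (cone_scalar). *)

(** * Polynomial functions on a cone and homogeneous vector fields *)

(** Congruence of polynomials modulo the ideal of X. *)
Definition eq_on (K : closedFieldType) N (X : set 'rV[K]_N)
    (p q : {mpoly K[N]}) : Prop :=
  forall x, X x -> p.@[x 0] = q.@[x 0].

Notation "p = q %[on X ]" := (eq_on X p q)
  (at level 70, q at next level, format "p  =  q  %[on  X ]").

Lemma sum_one (V : nmodType) r (f : nat -> V) i1 :
  (forall i, i != i1 -> f i = 0) -> ((r <= i1)%N -> f i1 = 0) ->
  \sum_(i < r) f i = f i1.
Proof.
move=> f0 fr; case: (ltnP i1 r) => [ir|/fr fi1].
  by rewrite (bigD1 (Ordinal ir)) //= big1 ?addr0 // => i; apply: f0.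
by rewrite fi1 big1 // => i _; have [->|/f0] := eqVneq (i : nat) i1.
Qed.

Lemma homogXU (K : closedFieldType) N i : ('X_i : {mpoly K[N]}) \is 1.-homog.
Proof. by rewrite dhomogX /= mdeg1. Qed.

Section Polynomials.
Variable K : closedFieldType.

Lemma poly_eval0 (p : {poly K}) : (forall t, p.[t] = 0) -> p = 0.
Proof.
move=> p0; apply/eqP/negPn/negP => /closed_nonrootP[t] /negP; apply.
by apply/eqP.
Qed.

(** Two derivations, or two ring morphisms, agree as soon as they agree on
    constants and variables; this principle packages that argument. *)
Lemma mpoly_ring_ind N (P : {mpoly K[N]} -> Prop) :
  (forall c, P c%:MP) -> (forall i, P 'X_i) ->
  (forall p q, P p -> P q -> P (p + q)) ->
  (forall p q, P p -> P q -> P (p * q)) -> forall p, P p.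
Proof.
move=> PC PX PD PM; elim/mpolyind => [|c m p _ _ Pp]; first by rewrite -mpolyC0.
apply: (PD) => //; rewrite -mul_mpolyC; apply: (PM) => //; rewrite mpolyXE_id.
apply: (big_ind P) => [||i _]; [by rewrite -mpolyC1 | exact: PM |].
elim: (m i) => [|k IH]; first by rewrite expr0 -mpolyC1.
by rewrite exprS; apply: (PM).
Qed.

Lemma homog_split N (p : {mpoly K[N]}) k :
  (msize p <= k)%N -> p = \sum_(d < k) pihomog mdeg d p.
Proof. by move=> /pihomog_partitionE. Qed.

Definition pullback M N (F : 'I_M -> {mpoly K[N]}) (p : {mpoly K[M]}) :=
  p \mPo [tuple F i | i < M].

Definition mapply M N (F : 'I_M -> {mpoly K[N]}) (x : 'rV[K]_N) : 'rV[K]_M :=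
  \row_j (F j).@[x 0].

Lemma pullbackE M N (F : 'I_M -> {mpoly K[N]}) p (x : 'rV[K]_N) :
  (pullback F p).@[x 0] = p.@[mapply F x 0].
Proof.
by rewrite comp_mpoly_meval; apply: meval_eq => i; rewrite mxE tnth_mktuple.
Qed.

Lemma mapplyZ M N (F : 'I_M -> {mpoly K[N]}) d c x :
  (forall j, F j \is d.-homog) -> mapply F (c *: x) = c ^+ d *: mapply F x.
Proof. by move=> hF; apply/rowP => j; rewrite !mxE (homog_eval _ _ (hF j)). Qed.

Lemma pullbackX M N (F : 'I_M -> {mpoly K[N]}) i : pullback F 'X_i = F i.
Proof. by rewrite /pullback comp_mpolyXU -tnth_nth tnth_mktuple. Qed.

Lemma pullbackC M N (F : 'I_M -> {mpoly K[N]}) c : pullback F c%:MP = c%:MP.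
Proof. exact: comp_mpolyC. Qed.

Lemma pullbackD M N (F : 'I_M -> {mpoly K[N]}) :
  {morph pullback F : p q / p + q}.
Proof. by move=> p q; apply: comp_mpolyD. Qed.

Lemma pullbackZ M N (F : 'I_M -> {mpoly K[N]}) c p :
  pullback F (c *: p) = c *: pullback F p.
Proof. exact: comp_mpolyZ. Qed.

Lemma pullback_sum M N (F : 'I_M -> {mpoly K[N]}) r (f : 'I_r -> {mpoly K[M]}) :
  pullback F (\sum_i f i) = \sum_i pullback F (f i).
Proof.
by apply: (big_morph _ (pullbackD F)); rewrite -mpolyC0 pullbackC.
Qed.

Lemma pullbackM M N (F : 'I_M -> {mpoly K[N]}) :
  {morph pullback F : p q / p * q}.
Proof. by move=> p q; apply: rmorphM. Qed.

Lemma homog0_const N (p : {mpoly K[N]}) : p \is 0.-homog -> p = (p@_0)%:MP.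
Proof.
move=> /dhomogP hp; apply: msize1_polyC; rewrite msizeE.
by apply/bigmax_leqP_seq => m /hp /= ->.
Qed.

Lemma meval_at0 N (p : {mpoly K[N]}) d :
  (0 < d)%N -> p \is d.-homog -> p.@[(0 : 'rV[K]_N) 0] = 0.
Proof.
move=> d0 hp; rewrite -(scale0r (0 : 'rV[K]_N)) (homog_eval _ _ hp).
by rewrite expr0n eqn0Ngt d0 mul0r.
Qed.

Section OnCone.
Variables (N : nat) (X : set 'rV[K]_N).
Hypothesis coneX : forall c x, X x -> X (c *: x).

(** The ideal of a cone is homogeneous: along the line through a point x the
    sum becomes a polynomial in the scaling parameter t whose coefficients are
    the values at x of the parts, and K is infinite. *)
Lemma eq_on_homog_sum k (c : nat -> {mpoly K[N]}) :
  (forall d, (d < k)%N -> c d \is d.-homog) ->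
  \sum_(d < k) c d = 0 %[on X] -> forall d, (d < k)%N -> c d = 0 %[on X].
Proof.
move=> hc c0 d dk x Xx.
have q0 : \poly_(e < k) (c e).@[x 0] = 0.
  apply: poly_eval0 => t; rewrite horner_poly.
  rewrite -[RHS](meval0 ((t *: x) 0)) -(c0 _ (coneX t Xx)) raddf_sum /=.
  by apply: eq_bigr => e _; rewrite (homog_eval _ _ (hc _ (ltn_ord e))) mulrC.
by have := coef_poly k (fun e => (c e).@[x 0]) d; rewrite q0 coef0 dk meval0.
Qed.

Lemma pihomog_on0 (p : {mpoly K[N]}) d :
  p = 0 %[on X] -> pihomog mdeg d p = 0 %[on X].
Proof.
move=> p0; set k := maxn (msize p) d.+1.
apply: (@eq_on_homog_sum k (fun d => pihomog mdeg d p)) => [e _||].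
- exact: pihomogP.
- by rewrite -homog_split ?leq_maxl.
- exact: leq_maxr.
Qed.

End OnCone.

Section LieDerivative.
Variables (N : nat).
Implicit Types (v : 'I_N -> {mpoly K[N]}) (p q : {mpoly K[N]}).

Definition lie v p : {mpoly K[N]} := \sum_i p^`M(i) * v i.

Lemma lie_is_linear v : linear (lie v).
Proof.
move=> c p q; rewrite /lie scaler_sumr -big_split /=; apply: eq_bigr => i _.
by rewrite linearP /= mulrDl scalerAl.
Qed.

HB.instance Definition _ v :=
  GRing.isLinear.Build K {mpoly K[N]} {mpoly K[N]} _ (lie v) (lie_is_linear v).

Lemma lieM v p q : lie v (p * q) = lie v p * q + p * lie v q.
Proof.
rewrite /lie mulr_suml mulr_sumr -big_split /=; apply: eq_bigr => i _.
by rewrite mderivM; ring.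
Qed.

Lemma lieC v c : lie v c%:MP = 0.
Proof. by rewrite /lie big1 // => i _; rewrite mderivC mul0r. Qed.

Lemma lieX v i : lie v 'X_i = v i.
Proof.
rewrite /lie (bigD1 i) //= big1 => [|j ji]; rewrite mderivX mnm1E.
  have -> : (U_(i) - U_(i))%MM = 0%MM :> 'X_{1..N}.
    by apply/mnmP => j; rewrite mnmBE subnn mnm0E.
  by rewrite eqxx scale1r mpolyX0 mul1r addr0.
by rewrite eq_sym (negbTE ji) scale0r mul0r.
Qed.

Lemma mderiv_homog p d i : p \is d.-homog -> p^`M(i) \is d.-1.-homog.
Proof.
move=> /dhomogP hp; apply/dhomogP => m.
rewrite mcoeff_msupp mcoeff_mderiv => pm.
have : (m + U_(i))%MM \in msupp p.
  by rewrite mcoeff_msupp; apply: contraNneq pm => ->; rewrite mul0rn.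
by move=> /hp /= <-; rewrite mdegD mdeg1 addn1.
Qed.

Lemma lie_homog v p d k : (forall i, v i \is k.-homog) -> p \is d.-homog ->
  lie v p \is (d + k).-1.-homog.
Proof.
move=> hv hp; have [d0|d0] := posnP d.
  by move: hp; rewrite d0 => /homog0_const ->; rewrite lieC dhomog0.
apply: rpred_sum => i _; rewrite -subn1 addnC -addnBA // addnC subn1.
by apply: dhomogM => //; apply: mderiv_homog.
Qed.

Lemma euler_homog p d :
  p \is d.-homog -> lie (fun i => 'X_i) p = d%:R *: p.
Proof.
move=> /dhomogP hp; rewrite [p]mpolyE linear_sum scaler_sumr.
apply: eq_big_seq => m /hp /= <-; rewrite linearZ /= scalerA mulrC -scalerA.
congr (_ *: _); rewrite mdegE natr_sum scaler_suml; apply: eq_bigr => i _.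
rewrite mderivX -scalerAl -mpolyXD; have [->|mi] := eqVneq (m i) 0%N.
  by rewrite !scale0r.
congr (_ *: 'X_[_]); apply: submK; apply/mnm_lepP => j; rewrite mnm1E.
by case: eqP => [<-|]//; rewrite lt0n.
Qed.

(** Differentiation along constant fields lowers the degree. *)
Lemma lie_const_nilp v p : (forall i, v i \is 0.-homog) ->
  exists j, iter j (lie v) p = 0.
Proof.
move=> hv; have H d q : q \is d.-homog -> iter d.+1 (lie v) q = 0.
  elim: d q => [|d IH] q hq; first by rewrite (homog0_const hq) /= lieC.
  by rewrite iterSr IH //; have := lie_homog hv hq; rewrite addn0.
have itD j a b : iter j (lie v) (a + b) = iter j (lie v) a + iter j (lie v) b.
  by elim: j => //= j ->; rewrite linearD.
have it0 j : iter j (lie v) 0 = 0 by elim: j => //= j ->; rewrite linear0.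
have G k : iter k (lie v) (\sum_(d < k) pihomog mdeg d p) = 0.
  elim: k => [|k IH]; first by rewrite big_ord0.
  rewrite big_ord_recr itD [X in _ + X]H ?addr0; last exact: pihomogP.
  by rewrite iterS IH linear0.
by exists (msize p); rewrite [X in iter _ _ X](homog_split (leqnn _)) G.
Qed.

End LieDerivative.

End Polynomials.

(** * Homogeneous locally nilpotent derivations *)

Section LocallyNilpotent.
Variables (K : closedFieldType) (N : nat) (X : set 'rV[K]_N).
Hypothesis char0 : forall m, m.+1%:R != 0 :> K.
Hypothesis primeX : forall p q : {mpoly K[N]}, p \is homog mdeg ->
  q \is homog mdeg -> p * q = 0 %[on X] -> p = 0 %[on X] \/ q = 0 %[on X].
Variables (u : 'I_N -> {mpoly K[N]}) (k : nat).
Hypothesis u_homog : forall i, u i \is k.-homog.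
Hypothesis u_on : forall p, p = 0 %[on X] -> lie u p = 0 %[on X].
Local Notation D := (lie u).

Lemma lie_on p q : p = q %[on X] -> D p = D q %[on X].
Proof.
move=> pq x Xx; apply/eqP; rewrite -subr_eq0 -mevalB -linearB /=.
have pq0 : p - q = 0 %[on X].
  by move=> y Xy; rewrite mevalB pq // subrr meval0.
by rewrite (u_on pq0 Xx) meval0.
Qed.

Lemma iter_lie_on j p q : p = q %[on X] -> iter j D p = iter j D q %[on X].
Proof. by move=> pq; elim: j => //= j IH; apply: lie_on. Qed.

Lemma iter_lie0 j : iter j D 0 = 0.
Proof. by elim: j => //= j ->; rewrite linear0. Qed.

Lemma iter_lieP j (c : K) p q :
  iter j D (c *: p + q) = c *: iter j D p + iter j D q.
Proof. by elim: j => //= j ->; rewrite linearP. Qed.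

Lemma iter_lieZ j (c : K) p : iter j D (c *: p) = c *: iter j D p.
Proof. by rewrite -[c *: p]addr0 iter_lieP iter_lie0 addr0. Qed.

Lemma iter_lieD j p q : iter j D (p + q) = iter j D p + iter j D q.
Proof. by rewrite -[p in LHS]scale1r iter_lieP scale1r. Qed.

Lemma iter_lie_sum j r (f : 'I_r -> {mpoly K[N]}) :
  iter j D (\sum_(i < r) f i) = \sum_(i < r) iter j D (f i).
Proof. exact: (big_morph _ (iter_lieD j) (iter_lie0 j)). Qed.

Lemma kerM p q : D p = 0 %[on X] -> D q = 0 %[on X] -> D (p * q) = 0 %[on X].
Proof.
move=> p0 q0 x Xx; rewrite lieM !(mevalD, mevalM) (p0 x Xx) (q0 x Xx) !meval0.
by rewrite mul0r mulr0 addr0.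
Qed.

Lemma kerX p j : D p = 0 %[on X] -> D (p ^+ j) = 0 %[on X].
Proof.
move=> p0; elim: j => [|j IH]; last by rewrite exprS; apply: kerM.
by move=> x Xx; rewrite expr0 -mpolyC1 lieC.
Qed.

Lemma ker_pullback M (G : 'I_M -> {mpoly K[N]}) p :
  (forall i, D (G i) = 0 %[on X]) -> D (pullback G p) = 0 %[on X].
Proof.
move=> G0; elim/mpoly_ring_ind: p => [c|i|p q p0 q0|p q p0 q0].
- by move=> x _; rewrite pullbackC lieC.
- by rewrite pullbackX.
- move=> x Xx; rewrite pullbackD linearD mevalD.
  by rewrite [X in X + _](p0 x Xx) [X in _ + X](q0 x Xx) -mevalD addr0.
- by rewrite pullbackM; apply: kerM.
Qed.

Lemma iter_lie_ker j b p :
  D b = 0 %[on X] -> iter j D (b * p) = b * iter j D p %[on X].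
Proof.
move=> b0; elim: j => [//|j IH] x Xx.
rewrite /= (lie_on IH Xx) lieM mevalD mevalM (b0 _ Xx) meval0 mul0r add0r.
by [].
Qed.

(** The degree is recorded by an equation without subtraction because D lowers
    degrees by one when k = 0. *)
Lemma iter_lie_homog j d p : p \is d.-homog ->
  iter j D p = 0 \/
  exists2 e, iter j D p \is e.-homog & (e + j = d + j * k)%N.
Proof.
move=> hp; elim: j => [|j [Dj|[e he ej]]].
- by right; exists d => //; rewrite mul0n !addn0.
- by left; rewrite iterS Dj linear0.
have [ek|ek] := posnP (e + k)%N.
  have e0 : e = 0%N by lia.
  by rewrite e0 in he; left; rewrite iterS (homog0_const he) lieC.
right; exists (e + k).-1; last by rewrite mulSn; lia.
by rewrite iterS; apply: lie_homog.
Qed.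

Variables (s a : {mpoly K[N]}) (m da : nat).
Hypothesis s_homog : s \is m.-homog.
Hypothesis a_homog : a \is da.-homog.
Hypothesis deg_slice : (da.+1 = m + k)%N.
Hypothesis Ds : D s = a %[on X].
Hypothesis Da : D a = 0 %[on X].
Hypothesis a_neq0 : ~ a = 0 %[on X].

(** The pair (s, a) behaves like a variable and its derivative: this is
    D = a d/ds, iterated j times, with ker D playing the role of constants. *)
Lemma iter_lie_slice j i b : D b = 0 %[on X] ->
  iter j D (b * s ^+ i) = (b * a ^+ j * s ^+ (i - j)) *+ (i ^_ j) %[on X].
Proof.
move=> b0; elim: j => [|j IH] x Xx.
  by rewrite ffactn0 subn0 expr0 mulr1.
have DX i' y : X y -> (D (s ^+ i')).@[y 0] = (s ^+ i'.-1 * a *+ i').@[y 0].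
  elim: i' y => [|i' IH'] y Xy; first by rewrite expr0 -mpolyC1 lieC mulr0n.
  rewrite exprS lieM mevalD !mevalM Ds // IH' //.
  case: i' {IH'} => [|i']; first by rewrite mulr0n meval0 mulr0 addr0 mulrC mulr1n mevalM.
  rewrite /= !mevalMn !mevalM -mulr_natr -[RHS]mulr_natr -[i'.+2]addn1 natrD exprS mevalM.
  by ring.
have ba0 : D (b * a ^+ j) = 0 %[on X] by apply: kerM => //; apply: kerX.
rewrite /= (lie_on IH Xx) raddfMn mevalMn /= lieM mevalD !mevalM.
rewrite (ba0 _ Xx) meval0 mul0r add0r DX // mevalMn -!subn1 -subnDA addn1.
rewrite ffactnSr mulrnA !mevalMn !mevalM exprSr mevalM.
rewrite -mulr_natr -[in LHS]mulr_natr -[RHS]mulr_natr -[in RHS]mulr_natr.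
by ring.
Qed.

(** Iterating D as often as the highest exponent isolates the leading
    coefficient, up to a factorial and a power of a. *)
Lemma slice_indep nu r (c : nat -> {mpoly K[N]}) : (0 < nu)%N ->
  (forall i, D (c i) = 0 %[on X]) -> (forall i, c i \is homog mdeg) ->
  \sum_(i < r) c i * s ^+ (nu * i) = 0 %[on X] ->
  forall i, (i < r)%N -> c i = 0 %[on X].
Proof.
move=> nu0 Dc hc; elim: r => // r IH c0.
have cr : c r = 0 %[on X].
  have : c r * a ^+ (nu * r) = 0 %[on X].
    move=> x Xx; have := iter_lie_on (nu * r) c0 Xx.
    rewrite iter_lie0 iter_lie_sum raddf_sum /= big_ord_recr /= big1 => [|i _].
      rewrite iter_lie_slice // subnn mulr1 ffactnn add0r mevalMn meval0 => /eqP.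
      rewrite -mulr_natr mulf_eq0; have := fact_gt0 (nu * r).
      by case: (_ `!) => // f _; rewrite (negbTE (char0 _)) orbF => /eqP.
    by rewrite iter_lie_slice // ffact_small ?mulr0n ?meval0 // ltn_pmul2l.
  case/primeX => [||//|aX]; first exact: hc.
    by apply/homogP; exists (da * (nu * r))%N; apply: dhomogMn.
  case: a_neq0; elim: (_ * _)%N aX => [|j IHj].
    by move=> h x Xx; rewrite -[a]mulr1 mevalM -(expr0 a) h // meval0 mulr0.
  move=> h x Xx; apply/eqP; have := h x Xx; rewrite meval0 rmorphXn => /eqP.
  by rewrite expf_eq0 => /andP[].
move=> i; rewrite ltnS leq_eqVlt => /predU1P[->//|]; apply: IH.
move=> x Xx; have := c0 x Xx; rewrite big_ord_recr mevalD /= mevalM cr //.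
by rewrite meval0 mul0r addr0.
Qed.

(** With b the last nonzero iterate of D on g, the combination
    j! a^j g - b s^j is killed one step earlier, which gives the expansion by
    induction. The degrees of the coefficients are carried along because the
    grading is what later selects the exponents that occur. *)
Lemma slice_expand j d g : g \is d.-homog -> iter j D g = 0 %[on X] ->
  exists M (c : nat -> {mpoly K[N]}),
    [/\ forall i, D (c i) = 0 %[on X],
        forall i, c i = 0 \/
          exists2 e, c i \is e.-homog & (e + i * m = M * da + d)%N,
        forall i, (j <= i)%N -> c i = 0
      & a ^+ M * g = \sum_(i < j) c i * s ^+ i %[on X]].
Proof.
elim: j d g => [|j IH] d g hg Dg.
  exists 0%N, (fun=> 0); split; rewrite ?linear0 //; first by left.
  by rewrite big_ord0 expr0 mul1r.
set b := iter j D g in Dg.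
have bj := iter_lie_homog j hg; rewrite -/b in bj.
have b_deg : b = 0 \/ exists2 e, b \is e.-homog & (e + j * m = j * da + d)%N.
  case: bj => [|[e he ej]]; [by left | right; exists e => //].
  by have : (j * da.+1 = j * (m + k))%N; [rewrite deg_slice | lia].
(* g' is killed by one iterate fewer, as iter j D (s^j) is j! a^j. *)
pose g' := (j`!)%:R *: (a ^+ j * g) - b * s ^+ j.
have hg' : g' \is (j * da + d).-homog.
  apply: rpredB; first by apply: rpredZ; apply: dhomogM => //; rewrite mulnC; apply: dhomogMn.
  case: b_deg => [->|[e he <-]]; first by rewrite mul0r dhomog0.
  by apply: dhomogM => //; rewrite mulnC; apply: dhomogMn.
have Dg' : iter j D g' = 0 %[on X].
  move=> x Xx; rewrite /g' iter_lieD iter_lieZ -scaleN1r iter_lieZ.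
  rewrite mevalD !mevalZ iter_lie_slice // subnn mulr1 ffactnn.
  rewrite (iter_lie_ker _ _ (kerX j Da) Xx) mevalMn !mevalM -/b meval0.
  by rewrite -mulr_natr; ring.
have [M [c [Dc hc c_out cE]]] := IH _ _ hg' Dg'.
have fj0 : (j`!)%:R != 0 :> K.
  by have := fact_gt0 j; case: (j`!) => // f _; apply: char0.
pose c' i := (j`!)%:R^-1 *: (if i == j then a ^+ M * b else c i).
exists (M + j)%N, c'; split.
- move=> i x Xx; rewrite linearZ mevalZ meval0 /=.
  have -> : (D (if i == j then a ^+ M * b else c i)).@[x 0] = 0.
    case: ifP => _; last by rewrite Dc // meval0.
    by rewrite (kerM (kerX M Da)) // meval0.
  by rewrite mulr0.
- move=> i; rewrite /c'; case: (eqVneq i j) => [->|_].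
    case: b_deg => [->|[e he ej]]; first by left; rewrite mulr0 scaler0.
    right; exists (M * da + e)%N; last by rewrite mulnDl -!addnA ej.
    by apply: rpredZ; apply: dhomogM => //; rewrite mulnC; apply: dhomogMn.
  case: (hc i) => [->|[e he ej]]; first by left; rewrite scaler0.
  by right; exists e; [apply: rpredZ | rewrite ej mulnDl addnA].
- move=> i ji; rewrite /c' gtn_eqF // c_out ?scaler0 //; exact: ltnW.
move=> x Xx; rewrite big_ord_recr /= /c' eqxx.
have cx := cE _ Xx; rewrite (eq_bigr (fun i : 'I_j => (j`!)%:R^-1 *: (c i * s ^+ i))); last first.
  by move=> i _; rewrite ltn_eqF // scalerAl.
rewrite -scaler_sumr mevalD !(mevalM, mevalZ) -cx /g' !(mevalM, mevalB, mevalZ).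
rewrite exprD mevalM; field; exact: fj0.
Qed.

Lemma neq0_onM p q : p \is homog mdeg -> q \is homog mdeg ->
  ~ p = 0 %[on X] -> ~ q = 0 %[on X] -> ~ p * q = 0 %[on X].
Proof. by move=> hp hq p0 q0 /primeX[]. Qed.

Lemma neq0_onX p j : ~ p = 0 %[on X] -> ~ p ^+ j = 0 %[on X].
Proof.
move=> p0 pj; apply: p0 => x Xx; have := pj x Xx; rewrite rmorphXn !meval0.
by move=> /eqP; rewrite expf_eq0 => /andP[_ /eqP].
Qed.

End LocallyNilpotent.

(** * From a locally nilpotent derivation to a ruling *)

(** A doubly indexed family as the coordinates of one point, in the order
    expected by mxvec. *)
Definition flat_forms (K : closedFieldType) N J Q
    (G : 'I_J -> 'I_Q -> {mpoly K[N]}) (l : 'I_(J * Q)) : {mpoly K[N]} :=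
  mxvec (\matrix_(j, q) G j q) 0 l.

(** The data from which a birational map from Y to the product of Z and the
    projective line is read off: z = (zform) and b = (b0 : b1) are the forward
    map, zform_coord gives back each coordinate of the point as a form in (z, b)
    up to the common factor w2 / w1, and b_transc says that b1 / b0 is
    transcendental over the field generated by the ratios of the zform. *)
Record ruling (K : closedFieldType) N (X : set 'rV[K]_N) := Ruling {
  deg_z : nat;
  deg_b : nat;
  bdeg : nat;
  zform : 'I_N -> 'I_bdeg.+1 -> {mpoly K[N]};
  b0 : {mpoly K[N]};
  b1 : {mpoly K[N]};
  w1 : {mpoly K[N]};
  w2 : {mpoly K[N]};
  zform_homog : forall j q, zform j q \is deg_z.-homog;
  b0_homog : b0 \is deg_b.-homog;
  b1_homog : b1 \is deg_b.-homog;
  deg_b_gt0 : (0 < deg_b)%N;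
  w1_homog : w1 \is homog mdeg;
  w2_homog : w2 \is homog mdeg;
  b0_neq0 : ~ b0 = 0 %[on X];
  w1_neq0 : ~ w1 = 0 %[on X];
  w2_neq0 : ~ w2 = 0 %[on X];
  zform_coord : forall j, w1 * (\sum_q zform j q * b1 ^+ q * b0 ^+ (bdeg - q)) =
    w2 * 'X_j %[on X];
  b_transc : forall r e (H : 'I_r.+1 -> {mpoly K[N * bdeg.+1]}),
    (forall q, H q \is e.-homog) ->
    \sum_q pullback (flat_forms zform) (H q) * b1 ^+ q * b0 ^+ (r - q) = 0 %[on X] ->
    forall q, pullback (flat_forms zform) (H q) = 0 %[on X]
}.

Lemma flat_forms_homog (K : closedFieldType) N J Q
    (G : 'I_J -> 'I_Q -> {mpoly K[N]}) d :
  (forall j q, G j q \is d.-homog) -> forall l, flat_forms G l \is d.-homog.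
Proof.
by move=> hG l; case/mxvec_indexP: l => j q; rewrite /flat_forms mxvecE mxE.
Qed.

Section RulingOfDerivation.
Variables (K : closedFieldType) (N : nat) (X : set 'rV[K]_N).
Hypothesis char0 : forall m, m.+1%:R != 0 :> K.
Hypothesis primeX : forall p q : {mpoly K[N]}, p \is homog mdeg ->
  q \is homog mdeg -> p * q = 0 %[on X] -> p = 0 %[on X] \/ q = 0 %[on X].
Hypothesis X_not_line : ~ exists v : 'rV[K]_N, forall x, X x -> exists t, x = t *: v.
Variables (u : 'I_N -> {mpoly K[N]}) (k : nat).
Hypothesis u_homog : forall i, u i \is k.-homog.
Hypothesis u_on : forall p, p = 0 %[on X] -> lie u p = 0 %[on X].
Local Notation D := (lie u).
Hypothesis u_nilp : forall p d, p \is d.-homog -> exists j, iter j D p = 0 %[on X].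
Hypothesis u_neq0 : ~ forall i, u i = 0 %[on X].

Lemma const_on0 : ~ (1 : {mpoly K[N]}) = 0 %[on X].
Proof.
move=> h; apply: X_not_line; exists 0 => x /h /eqP.
by rewrite meval1 meval0 oner_eq0.
Qed.

(** Follow a coordinate not killed by D until its last nonzero iterate a; the
    iterate before it is s. *)
Lemma ex_slice : exists s a m da,
  [/\ s \is m.-homog, a \is da.-homog, (da.+1 = m + k)%N &
   [/\ (0 < m)%N, D s = a, D a = 0 %[on X] & ~ a = 0 %[on X]]].
Proof.
have [i ui] : exists i, ~ u i = 0 %[on X].
  by apply/existsNP.
have exj : exists j, `[< iter j D 'X_i = 0 %[on X] >].
  by have [j hj] := u_nilp (homogXU _ i); exists j; apply/asboolP.
case: (ex_minnP exj) => -[|[|j]] /asboolP hj minj.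
- case: ui => x Xx; have /= := lie_on u_on hj Xx.
  by rewrite lieX linear0.
- by case: ui => x Xx; have := hj x Xx; rewrite /= lieX.
have a0 : ~ iter j.+1 D 'X_i = 0 %[on X].
  by move=> h; have := minj j.+1; rewrite ltnn => /(_ (asboolT h)).
have [sz|[m hm mj]] := iter_lie_homog u_homog j (homogXU _ i).
  by case: a0; rewrite iterS sz linear0.
have [az|[da ha daj]] := iter_lie_homog u_homog j.+1 (homogXU _ i).
  by case: a0; rewrite az.
exists (iter j D 'X_i), (iter j.+1 D 'X_i), m, da; split=> //; first by lia.
split=> //; rewrite lt0n; apply/eqP => m0; apply: a0; rewrite iterS.
by move: hm; rewrite m0 => /homog0_const ->; rewrite lieC.
Qed.

Section Slice.
Variables (s a : {mpoly K[N]}) (m da : nat).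
Hypothesis s_homog : s \is m.-homog.
Hypothesis a_homog : a \is da.-homog.
Hypothesis deg_slice : (da.+1 = m + k)%N.
Hypothesis m_gt0 : (0 < m)%N.
Hypothesis Ds : D s = a.
Hypothesis Da : D a = 0 %[on X].
Hypothesis a_neq0 : ~ a = 0 %[on X].

Lemma s_neq0 : ~ s = 0 %[on X].
Proof. by move=> s0; apply: a_neq0; rewrite -Ds; apply: u_on. Qed.

(** The exponent of a and the range of summation are made common to all
    coordinates, and coefficients vanishing on X are replaced by zero, so that
    later a nonzero coefficient is nonzero on X and has a degree. *)
Lemma expand_coords : exists M r (c : 'I_N -> nat -> {mpoly K[N]}),
  [/\ forall j i, D (c j i) = 0 %[on X],
      forall j i, c j i = 0 \/ ~ c j i = 0 %[on X] /\
        exists2 e, c j i \is e.-homog & (e + i * m = M * da + 1)%N,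
      forall j i, (r <= i)%N -> c j i = 0
    & forall j, a ^+ M * 'X_j = \sum_(i < r) c j i * s ^+ i %[on X]].
Proof.
have /choice[h hP] : forall j : 'I_N, exists h : nat * nat * (nat -> {mpoly K[N]}),
    [/\ forall i, D (h.2 i) = 0 %[on X],
        forall i, h.2 i = 0 \/
          exists2 e, h.2 i \is e.-homog & (e + i * m = h.1.2 * da + 1)%N,
        forall i, (h.1.1 <= i)%N -> h.2 i = 0
      & a ^+ h.1.2 * 'X_j = \sum_(i < h.1.1) h.2 i * s ^+ i %[on X]].
  move=> j; have [r hr] := u_nilp (homogXU _ j).
  have Ds' : D s = a %[on X] by rewrite Ds.
  have [M [c cP]] := slice_expand char0 u_homog u_on s_homog a_homog deg_slice
    Ds' Da (homogXU _ j) hr.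
  by exists (r, M, c).
pose M := (\sum_j (h j).1.2)%N; pose r := (\sum_j (h j).1.1)%N.
have leM j : ((h j).1.2 <= M)%N by rewrite /M (bigD1 j) //= leq_addr.
have ler j : ((h j).1.1 <= r)%N by rewrite /r (bigD1 j) //= leq_addr.
pose c0 j i := a ^+ (M - (h j).1.2) * (h j).2 i.
pose c j i := if `[< c0 j i = 0 %[on X] >] then 0 else c0 j i.
have cE j i : c j i = c0 j i %[on X].
  by rewrite /c; case: asboolP => // h0 x Xx; rewrite h0.
exists M, r, c; split.
- move=> j i x Xx; rewrite (lie_on u_on (cE j i) Xx); have [Dc _ _ _] := hP j.
  by rewrite (kerM (kerX (M - (h j).1.2) Da) (Dc i)).
- move=> j i; rewrite /c; case: asboolP => [_|c0N]; first by left.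
  have [_ hc _ _] := hP j; case: (hc i) => [ci|[e he ei]].
    by case: c0N => x _; rewrite /c0 ci mulr0.
  right; split=> //; exists ((M - (h j).1.2) * da + e)%N.
    by apply: dhomogM => //; rewrite mulnC; apply: dhomogMn.
  by rewrite -addnA ei addnA -mulnDl subnK.
- move=> j i ri; have [_ _ cout _] := hP j.
  by rewrite /c /c0 cout ?mulr0 ?(leq_trans (ler j)) //; case: ifP.
move=> j x Xx; have [_ _ cout cX] := hP j.
rewrite raddf_sum /= (eq_bigr (fun i : 'I_r => (c0 j i * s ^+ i).@[x 0])); last first.
  by move=> i _; rewrite mevalM (cE _ _ x Xx) -mevalM.
rewrite -(subnK (leM j)) exprD -mulrA mevalM (cX x Xx) -mevalM.
rewrite -raddf_sum; congr (_.@[x 0]).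
rewrite mulr_sumr (big_ord_widen _ (fun i => a ^+ (M - (h j).1.2) * ((h j).2 i * s ^+ i)) (ler j)).
rewrite big_mkcond; apply: eq_bigr => i _; rewrite /c0 mulrA.
by case: ltnP => // hi; rewrite cout // mulr0 mul0r.
Qed.

(** If ker D had only constants, a would be constant and every coordinate would
    be a scalar multiple of s, so X would be contained in a line. *)
Lemma ex_ker_pos : exists c e,
  [/\ c \is e.-homog, (0 < e)%N, D c = 0 %[on X] & ~ c = 0 %[on X]].
Proof.
have [da0|da_gt0] := posnP da; last by exists a, da.
apply: contrapT => none; apply: X_not_line.
have [M [r [c [Dc hc cout cX]]]] := expand_coords.
have c1 j i : i != 1%N -> c j i = 0.
  case: (hc j i) => // -[c0 [e he]]; rewrite da0 muln0 add0n.
  have [->|e_gt0] := posnP e; first by lia.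
  by case: none; exists (c j i), e.
have cC j : c j 1%N = ((c j 1%N)@_0)%:MP.
  case: (hc j 1%N) => [->|[c0 [e he _]]]; first by rewrite mcoeff0 mpolyC0.
  have [e0|e_gt0] := posnP e; first by apply: homog0_const; rewrite e0 in he.
  by case: none; exists (c j 1%N), e.
have aC : a = (a@_0)%:MP.
    by move: a_homog; rewrite da0; apply: homog0_const.
have a0 : a@_0 != 0.
  by apply/eqP => a00; apply: a_neq0 => x _; rewrite aC a00 mpolyC0.
exists (\row_j ((a@_0) ^- M * (c j 1%N)@_0)) => x Xx; exists (s.@[x 0]).
apply/rowP => j; rewrite !mxE mulrCA.
apply: (mulfI (expf_neq0 M a0)); rewrite [RHS]mulrA divff ?expf_neq0 // mul1r.
have aE : a.@[x 0] = a@_0 by rewrite {1}aC mevalC.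
have := cX j x Xx; rewrite mevalM mevalXU rmorphXn /= aE => ->.
rewrite raddf_sum /=.
rewrite (sum_one (f := fun i => (c j i * s ^+ i).@[x 0]) (i1 := 1%N)).
- by rewrite mevalM [in LHS]cC mevalC mulrC expr1.
- by move=> i /c1 ->; rewrite mul0r meval0.
- by move=> r1; rewrite cout // mul0r meval0.
Qed.

Let ker_homog (c : {mpoly K[N]}) e :=
  [/\ c \is e.-homog, D c = 0 %[on X] & ~ c = 0 %[on X]].

Let ker_homogM c e c' e' : ker_homog c e -> ker_homog c' e' ->
  ker_homog (c * c') (e + e').
Proof.
move=> [hc Dc c0] [hc' Dc' c0']; split; [exact: dhomogM | exact: kerM |].
by apply: neq0_onM => //; apply/homogP; [exists e | exists e'].
Qed.

Let ker_homogX c e j : ker_homog c e -> ker_homog (c ^+ j) (e * j).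
Proof.
by move=> [hc Dc c0]; split; [exact: dhomogMn | exact: kerX | exact: neq0_onX].
Qed.

(** The numbers nu for which s^nu times a homogeneous fraction of ker D has
    degree 0. *)
Let is_period nu := (0 < nu)%N /\ exists h1 h2 e1 e2,
  [/\ ker_homog h1 e1, ker_homog h2 e2 & (e1 = e2 + nu * m)%N].

(** Euclidean division: the remainder of i - i' modulo nu would itself be a
    period, using quotients by powers of h1 / h2. *)
Lemma period_dvd nu c e i c' e' i' : is_period nu ->
  (forall nu', is_period nu' -> (nu <= nu')%N) ->
  ker_homog c e -> ker_homog c' e' -> (e + i * m = e' + i' * m)%N ->
  (i' <= i)%N -> (nu %| i - i')%N.
Proof.
move=> [nu0 [h1 [h2 [e1 [e2 [H1 H2 e12]]]]]] minnu Hc Hc' eq_deg le_i.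
set t := (i - i')%N; have e'E : (e' = e + t * m)%N.
  have := eq_deg; rewrite -(subnK le_i) -/t mulnDl addnA => /eqP.
  by rewrite eqn_add2r => /eqP.
apply: contraT => ndvd.
have r0 : (0 < t %% nu)%N by rewrite lt0n.
suff : is_period (t %% nu)%N by move=> /minnu; rewrite leqNgt ltn_pmod.
split=> //; pose q := (t %/ nu)%N.
exists (c' * h2 ^+ q), (c * h1 ^+ q), (e' + e2 * q)%N, (e + e1 * q)%N.
split; try (by apply: ker_homogM => //; apply: ker_homogX).
rewrite e'E e12 {1}(divn_eq t nu) -/q; lia.
Qed.

Lemma ruling_of_slice : exists _ : ruling X, True.
Proof.
have [M [r [c [Dc hc cout cX]]]] := expand_coords.
have ex_nu : exists nu, `[< is_period nu >].
  have [b [e [hb e0 Db b_neq0]]] := ex_ker_pos.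
  exists e; apply/asboolP; split=> //.
  (* b^m and s^e have the same degree. *)
  exists (b ^+ m), 1, (e * m)%N, 0%N; split=> //; first exact: ker_homogX.
  split; [exact: dhomog1| |exact: const_on0].
  by move=> x _; rewrite -mpolyC1 lieC.
case: (ex_minnP ex_nu) => nu /asboolP nuP min_nu'.
have min_nu nu' : is_period nu' -> (nu <= nu')%N.
  by move=> h; apply: min_nu'; apply/asboolP.
have ex_i : exists i, [exists j, c j i != 0].
  apply: contrapT => none; apply: X_not_line; exists 0 => x Xx; exists 0.
  rewrite scaler0; apply/rowP => j; rewrite mxE.
  have : a ^+ M * 'X_j = 0 %[on X].
    move=> y Xy; rewrite cX // big1 // => i _; have [->|cji] := eqVneq (c j i) 0.
      by rewrite mul0r.
    by case: none; exists i; apply/existsP; exists j.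
  case/primeX => [||aM0|/(_ x Xx)].
  - by apply/homogP; exists (da * M)%N; apply: dhomogMn.
  - by apply/homogP; exists 1%N; apply: homogXU.
  - by case: (neq0_onX a_neq0 aM0).
  by rewrite mevalXU meval0.
(* s^i0 is the highest power of s dividing all the expansions. *)
case: (ex_minnP ex_i) => i0 /existsP[j0 cj0] min_i0.
have ker_c j i : c j i != 0 -> exists2 e, ker_homog (c j i) e &
    (e + i * m = M * da + 1)%N.
  move=> cji; case: (hc j i) => [/eqP|[c_neq0 [e he ei]]].
    by rewrite (negbTE cji).
  by exists e.
have supp j i : c j i != 0 -> exists2 q, (q <= r)%N & i = (i0 + nu * q)%N.
  move=> cji; have le_i : (i0 <= i)%N by apply: min_i0; apply/existsP; exists j.
  have [e He ee] := ker_c _ _ cji; have [e' He' ee'] := ker_c _ _ cj0.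
  have /dvdnP[q qE] : (nu %| i - i0)%N.
    by apply: (period_dvd nuP min_nu He He') => //; rewrite ee ee'.
  have nu0 := nuP.1; exists q; last by rewrite mulnC -qE addnC subnK.
  have ir : (i < r)%N by rewrite ltnNge; apply: contra cji => /cout ->.
  have : (q <= q * nu)%N by rewrite leq_pmulr.
  by rewrite -qE; lia.
have [nu0 [h1 [h2 [e1 [e2 [H1 H2 e12]]]]]] := nuP.
have [hh1 Dh1 h1_neq0] := H1; have [hh2 Dh2 h2_neq0] := H2.
(* The powers of h1 and h2 bring all coefficients to one degree. Since nu > 0,
   the bound r on the exponents of s also bounds q. *)
pose G (j : 'I_N) (q : 'I_r.+1) := c j (i0 + nu * q)%N * h1 ^+ q * h2 ^+ (r - q).
pose d1 := (M * da + 1 + r * e2 - i0 * m)%N.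
have hG j q : G j q \is d1.-homog.
  rewrite /G; have [->|cji] := eqVneq (c j (i0 + nu * q)%N) 0.
    by rewrite !mul0r dhomog0.
  have [e [he _ _] ee] := ker_c _ _ cji.
  have -> : d1 = (e + e1 * q + e2 * (r - q))%N.
    rewrite /d1 -ee e12; have := ltn_ord q; rewrite ltnS => qr.
    have -> : (r * e2 = q * e2 + (r - q) * e2)%N by rewrite -mulnDl subnKC.
    by lia.
  by apply: dhomogM; [apply: dhomogM => // | ]; apply: dhomogMn.
have hb1 : h2 * s ^+ nu \is e1.-homog.
  by rewrite e12; apply: dhomogM => //; rewrite mulnC; apply: dhomogMn.
have e1_gt0 : (0 < e1)%N by rewrite e12 addn_gt0 muln_gt0 nu0 m_gt0 orbT.
have hw1 : s ^+ i0 \is homog mdeg.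
  by apply/homogP; exists (m * i0)%N; apply: dhomogMn.
have hw2 : (h1 * h2) ^+ r * a ^+ M \is homog mdeg.
  apply/homogP; exists ((e1 + e2) * r + da * M)%N.
  by apply: dhomogM; apply: dhomogMn => //; apply: dhomogM.
have w1_neq0' : ~ s ^+ i0 = 0 %[on X] by apply: neq0_onX; apply: s_neq0.
have w2_neq0' : ~ (h1 * h2) ^+ r * a ^+ M = 0 %[on X].
  apply: neq0_onM => //.
  - by apply/homogP; exists ((e1 + e2) * r)%N; apply/dhomogMn/dhomogM.
  - by apply/homogP; exists (da * M)%N; apply: dhomogMn.
  - by apply: neq0_onX; have [] := ker_homogM H1 H2.
  - exact: neq0_onX.
have GX j : s ^+ i0 * (\sum_q G j q * (h2 * s ^+ nu) ^+ q * h1 ^+ (r - q)) =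
    (h1 * h2) ^+ r * a ^+ M * 'X_j %[on X].
  move=> x Xx; rewrite -mulrA mevalM [RHS]mevalM (cX j x Xx) -!mevalM; congr (_.@[x 0]).
  pose f i := c j i * s ^+ i.
  have -> : \sum_(i < r) c j i * s ^+ i = \sum_(q < r.+1) f (i0 + nu * q)%N.
    transitivity (\sum_(q < r.+1) \sum_(i < r)
        (if i == (i0 + nu * q)%N :> nat then f i else 0)).
      rewrite exchange_big /=; apply: eq_bigr => i _; rewrite -/(f i).
      have [c0|/supp[q qr qE]] := eqVneq (c j i) 0.
        by rewrite /f c0 mul0r big1 // => q _; case: ifP.
      rewrite (sum_one (f := fun q => if i == (i0 + nu * q)%N :> nat then f i else 0) (i1 := q)).
      - by rewrite -qE eqxx.
      - move=> q' q'q; rewrite qE eqn_add2l eqn_pmul2l // eq_sym (negbTE q'q) //.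
      - by rewrite ltnNge qr.
    apply: eq_bigr => q _.
    rewrite (sum_one (f := fun i => if i == (i0 + nu * q)%N :> nat then f i else 0)
      (i1 := (i0 + nu * q)%N)) ?eqxx // => [i /negbTE -> //|ri].
    by rewrite /f cout // mul0r.
  rewrite !mulr_sumr; apply: eq_bigr => q _; rewrite /G /f.
  have qr : (q <= r)%N by rewrite -ltnS.
  rewrite exprD exprM !exprMn.
  have split_r (z : {mpoly K[N]}) : z ^+ r = z ^+ q * z ^+ (r - q).
    by rewrite -exprD subnKC.
  rewrite (split_r h1) (split_r h2); ring.
apply: (ex_intro _ (Ruling hG hh1 hb1 e1_gt0 hw1 hw2 h1_neq0 w1_neq0' w2_neq0'
  GX _) I).
move=> r0 e H hH H0 q.
(* The coefficients indexed by all natural numbers, as slice_indep takes them. *)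
pose C i := if insub i is Some q
  then pullback (flat_forms G) (H q) * h2 ^+ i * h1 ^+ (r0 - i) else 0.
have DG l : D (flat_forms G l) = 0 %[on X].
  case/mxvec_indexP: l => j q'; rewrite /flat_forms mxvecE mxE /G.
  by apply: kerM; [apply: kerM | ]; try exact: kerX; apply: Dc.
have hpb q' : pullback (flat_forms G) (H q') \is (d1 * e).-homog.
  by apply: homog_comp => //; apply: flat_forms_homog.
have hC i : C i \is homog mdeg.
  rewrite /C; case: insubP => [q' _ _|_]; last by apply/homogP; exists 0%N; apply: dhomog0.
  apply/homogP; exists (d1 * e + e2 * i + e1 * (r0 - i))%N.
  by apply: dhomogM; [apply: dhomogM => // | ]; apply: dhomogMn.
have DC i : D (C i) = 0 %[on X].
  rewrite /C; case: insubP => [q' _ _|_]; last by move=> x _; rewrite linear0.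
  by apply: kerM; [apply: kerM | ]; try exact: kerX; apply: ker_pullback.
have CE (q' : 'I_r0.+1) : C q' = pullback (flat_forms G) (H q') * h2 ^+ q' * h1 ^+ (r0 - q').
  by rewrite /C valK.
have : C q = 0 %[on X].
  have Ds' : D s = a %[on X] by rewrite Ds.
  apply: (slice_indep char0 primeX u_on a_homog Ds' Da a_neq0 nu0 DC hC (r := r0.+1)) => //.
  move=> x Xx; rewrite -(H0 x Xx); congr (_.@[x 0]); apply: eq_bigr => q' _.
  by rewrite CE exprM exprMn; ring.
have hX h d j : h \is d.-homog -> h ^+ j \is homog mdeg.
  by move=> hh; apply/homogP; exists (d * j)%N; apply: dhomogMn.
rewrite CE -mulrA => /primeX[||//|].
- by apply/homogP; exists (d1 * e)%N.
- by apply/homogP; exists (e2 * q + e1 * (r0 - q))%N; apply: dhomogM; apply: dhomogMn.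
case/primeX => [||/(neq0_onX h2_neq0)|/(neq0_onX h1_neq0)] //.
  by apply: hX hh2.
by apply: hX hh1.
Qed.

End Slice.

Lemma ruling_of_derivation : exists _ : ruling X, True.
Proof.
have [s [a [m [da [hs ha deg [m0 Ds Da a0]]]]]] := ex_slice.
exact: (ruling_of_slice hs ha deg m0 Ds Da a0).
Qed.

End RulingOfDerivation.

(** * Points of projective space and bihomogeneous functions *)

Section Points.
Variables (K : closedFieldType) (N : nat).
Implicit Types (P Q : pspace K N) (x y : 'rV[K]_N).

Lemma coords_neq0 P x : coords P x -> x != 0.
Proof.
rewrite /coords => Px; apply/eqP => x0; have := valP P.
by rewrite /= Px x0 dim_vline eqxx.
Qed.

Lemma coordsZ P c x : c != 0 -> coords P x -> coords P (c *: x).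
Proof. by rewrite /coords => c0 ->; rewrite vlineZ. Qed.

Lemma point_ex x : x != 0 -> exists P, coords P x.
Proof.
move=> x0; have dx : \dim <[x]>%VS == 1%N by rewrite dim_vline x0.
by exists (exist _ <[x]>%VS dx).
Qed.

Lemma coords_prop P x y : coords P x -> coords P y ->
  exists2 c, c != 0 & y = c *: x.
Proof.
move=> Px Py; have : y \in <[x]>%VS by rewrite -Px Py memv_line.
move=> /vlineP[c yE]; exists c => //; apply/eqP => c0.
by have := coords_neq0 Py; rewrite yE c0 scale0r eqxx.
Qed.

Lemma coords_inj P Q x : coords P x -> coords Q x -> P = Q.
Proof. by rewrite /coords => Px Qx; apply: val_inj; rewrite /= Px Qx. Qed.

Lemma vanishesE F P x : F \is homog mdeg -> coords P x ->
  vanishes F P <-> F.@[x 0] = 0.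
Proof.
move=> hF Px; split=> [|Fx]; first exact.
by apply: contrapT => /(not_vanishes hF Px); rewrite Fx eqxx.
Qed.

End Points.

Section Bihomogeneous.
Variables (K : closedFieldType) (M : nat).
Implicit Types A B : 'rV[K]_M -> 'rV[K]_2 -> K.

(** Forms of bidegree (p, r) on the product of an affine space and the affine
    plane, written by powers of the second variable so that transcendence of
    b1 / b0 applies to the coefficients. *)
Definition bihomog p r A := exists H : 'I_r.+1 -> {mpoly K[M]},
  (forall q, H q \is p.-homog) /\
  forall z b, A z b = \sum_q (H q).@[z 0] * b 0 1 ^+ q * b 0 0 ^+ (r - q).

Lemma bihomog_eq p r A B : (forall z b, A z b = B z b) ->
  bihomog p r A -> bihomog p r B.
Proof. by move=> AB [H [hH HE]]; exists H; split=> // z b; rewrite -AB. Qed.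

Lemma bihomogZ p r c A : bihomog p r A -> bihomog p r (fun z b => c * A z b).
Proof.
move=> [H [hH HE]]; exists (fun q => c *: H q); split=> [q|z b].
  exact: rpredZ.
by rewrite HE mulr_sumr; apply: eq_bigr => q _; rewrite mevalZ -!mulrA.
Qed.

Lemma bihomogD p r A B : bihomog p r A -> bihomog p r B ->
  bihomog p r (fun z b => A z b + B z b).
Proof.
move=> [H [hH HE]] [H' [hH' HE']]; exists (fun q => H q + H' q); split=> [q|z b].
  exact: rpredD.
rewrite HE HE' -big_split /=; apply: eq_bigr => q _.
by rewrite mevalD !mulrDl.
Qed.

Lemma bihomog0 p r : bihomog p r (fun _ _ => 0).
Proof.
exists (fun=> 0); split=> [q|z b]; first exact: dhomog0.
by rewrite big1 // => q _; rewrite meval0 !mul0r.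
Qed.

Lemma bihomog1 : bihomog 0 0 (fun _ _ => 1).
Proof.
exists (fun=> 1); split=> [q|z b]; first exact: dhomog1.
by rewrite big_ord1 meval1 !expr0 !mulr1.
Qed.

Lemma bihomog_sum (I : eqType) (s : seq I) p r (A : I -> _) :
  (forall i, i \in s -> bihomog p r (A i)) ->
  bihomog p r (fun z b => \sum_(i <- s) A i z b).
Proof.
elim: s => [_|i s IH hA].
  by apply: bihomog_eq (bihomog0 p r) => z b; rewrite big_nil.
have hs : bihomog p r (fun z b => \sum_(i <- s) A i z b).
  by apply: IH => j js; apply: hA; rewrite inE js orbT.
apply: bihomog_eq (bihomogD (hA i (mem_head _ _)) hs) => z b.
by rewrite big_cons.
Qed.

Lemma bihomog_form p (F : {mpoly K[M]}) :
  F \is p.-homog -> bihomog p 0 (fun z _ => F.@[z 0]).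
Proof.
move=> hF; exists (fun=> F); split=> // z b.
by rewrite big_ord1 !expr0 !mulr1.
Qed.

Lemma bihomogM p r A p' r' B : bihomog p r A -> bihomog p' r' B ->
  bihomog (p + p') (r + r') (fun z b => A z b * B z b).
Proof.
move=> [H [hH HE]] [H' [hH' HE']].
exists (fun t : 'I_(r + r').+1 => \sum_(i < r.+1) \sum_(j < r'.+1)
  if (i + j == t :> nat)%N then H i * H' j else 0); split=> [t|z b].
  apply: rpred_sum => i _; apply: rpred_sum => j _.
  by case: ifP => _; [apply: dhomogM | apply: dhomog0].
rewrite HE HE' mulr_suml.
transitivity (\sum_(i < r.+1) \sum_(j < r'.+1) \sum_(t < (r + r').+1)
  (if (i + j == t :> nat)%N then (H i * H' j).@[z 0] * b 0 1 ^+ t * b 0 0 ^+ (r + r' - t)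
   else 0)); last first.
  under eq_bigr do rewrite exchange_big /=.
  rewrite exchange_big; apply: eq_bigr => t _.
  rewrite raddf_sum !mulr_suml; apply: eq_bigr => i _.
  rewrite raddf_sum !mulr_suml; apply: eq_bigr => j _.
  by case: ifP => _ //=; rewrite meval0 !mul0r.
apply: eq_bigr => i _; rewrite mulr_sumr; apply: eq_bigr => j _.
have ir : (i <= r)%N by rewrite -ltnS.
have jr : (j <= r')%N by rewrite -ltnS.
rewrite (sum_one (f := fun t => if (i + j == t :> nat)%N then
  (H i * H' j).@[z 0] * b 0 1 ^+ t * b 0 0 ^+ (r + r' - t) else 0) (i1 := (i + j)%N)).
- rewrite eqxx mevalM !exprD.
  have -> : (r + r' - (i + j) = (r - i) + (r' - j))%N by lia.
  by rewrite exprD; ring.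
- by move=> t; rewrite eq_sym => /negbTE ->.
- by move=> h; exfalso; lia.
Qed.

Lemma bihomogX p r A d : bihomog p r A ->
  bihomog (d * p) (d * r) (fun z b => A z b ^+ d).
Proof.
move=> hA; elim: d => [|d IH]; first exact: bihomog1.
by rewrite !mulSn; apply: bihomog_eq (bihomogM hA IH) => z b; rewrite exprS.
Qed.

Lemma bihomog_comp p r N d (F : {mpoly K[N]}) (A : 'I_N -> _) :
  F \is d.-homog -> (forall j, bihomog p r (A j)) ->
  bihomog (d * p) (d * r) (fun z b => F.@[(\row_j A j z b) 0]).
Proof.
move=> /dhomogP hF hA.
apply: (@bihomog_eq _ _ (fun z b =>
  \sum_(m <- msupp F) F@_m * \prod_(i < N) A i z b ^+ m i)).
  move=> z b; rewrite mevalE; apply: eq_bigr => m _; congr (_ * _).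
  by apply: eq_bigr => i _; rewrite mxE.
apply: bihomog_sum => m /hF /= <-; apply: bihomogZ; rewrite mdegE.
elim: (index_enum _) => [|i s IH].
  by rewrite !big_nil; apply: bihomog_eq bihomog1 => z b; rewrite big_nil.
rewrite big_cons !mulnDl; apply: bihomog_eq (bihomogM (bihomogX (m i) (hA i)) IH).
by move=> z b; rewrite big_cons.
Qed.

Lemma bihomog_scale p r A c e z b : bihomog p r A ->
  A (c *: z) (e *: b) = c ^+ p * e ^+ r * A z b.
Proof.
move=> [H [hH HE]]; rewrite !HE mulr_sumr; apply: eq_bigr => q _.
have qr : (q <= r)%N by rewrite -ltnS.
rewrite (homog_eval _ _ (hH q)) !mxE !exprMn.
have -> : e ^+ r = e ^+ q * e ^+ (r - q) by rewrite -exprD subnKC.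
by ring.
Qed.

Definition scol (c : 'I_2) (y : 'rV[K]_(M * 2)) : 'rV[K]_M := \row_l vec_mx y l c.
Definition srow (l : 'I_M) (y : 'rV[K]_(M * 2)) : 'rV[K]_2 := \row_c vec_mx y l c.

(** A row and a column of the matrix of Segre coordinates are multiples of the
    two factors, so evaluating there gives a form in the Segre coordinates,
    even when the two degrees differ. *)
Lemma bihomog_segre p r A l c : bihomog p r A ->
  exists2 F : {mpoly K[M * 2]}, F \is (p + r).-homog &
    forall y : 'rV[K]_(M * 2), F.@[y 0] = A (scol c y) (srow l y).
Proof.
move=> [H [hH HE]].
exists (\sum_q pullback (fun l' => 'X_(mxvec_index l' c)) (H q) *
  'X_(mxvec_index l 1) ^+ q * 'X_(mxvec_index l 0) ^+ (r - q)).
  have hX i k : ('X_i : {mpoly K[M * 2]}) ^+ k \is k.-homog.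
    by have := dhomogMn k (homogXU K i); rewrite mul1n.
  apply: rpred_sum => q _; have qr : (q <= r)%N by rewrite -ltnS.
  have -> : (p + r = p + q + (r - q))%N by rewrite -addnA subnKC.
  do 2?[apply: dhomogM => //].
  by rewrite -[p]mul1n; apply: homog_comp => // j; apply: homogXU.
move=> y; rewrite HE raddf_sum /=; apply: eq_bigr => q _.
rewrite !mevalM !rmorphXn /= !mevalXU pullbackE !mxE.
congr (_ * _ * _); apply: meval_eq => l'.
by rewrite !mxE mevalXU.
Qed.

Definition segre (z : 'rV[K]_M) (b : 'rV[K]_2) : 'rV[K]_(M * 2) := mxvec (z^T *m b).

Lemma segreE z b l c : vec_mx (segre z b) l c = z 0 l * b 0 c.
Proof. by rewrite mxvecK !mxE big_ord1 mxE. Qed.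

Lemma scol_segre z b c : scol c (segre z b) = b 0 c *: z.
Proof. by apply/rowP => l; rewrite mxE segreE mxE mulrC. Qed.

Lemma srow_segre z b l : srow l (segre z b) = z 0 l *: b.
Proof. by apply/rowP => c; rewrite mxE segreE mxE. Qed.

Lemma scolZ k c y : scol c (k *: y) = k *: scol c y.
Proof. by apply/rowP => l; rewrite mxE linearZ /= !mxE. Qed.

Lemma srowZ k l y : srow l (k *: y) = k *: srow l y.
Proof. by apply/rowP => c; rewrite mxE linearZ /= !mxE. Qed.

Lemma segreZ k e z b : segre (k *: z) (e *: b) = (k * e) *: segre z b.
Proof.
apply: (can_inj vec_mxK); apply/matrixP => l c.
by rewrite segreE linearZ /= [RHS]mxE segreE !mxE mulrACA.
Qed.

Lemma row_neq0 N (z : 'rV[K]_N) : z != 0 -> exists l, z 0 l != 0.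
Proof.
move=> z0; apply/existsP; apply: contraT; rewrite negb_exists => /forallP h.
case/negP: z0; apply/eqP/rowP => l; rewrite mxE; apply/eqP.
by have := h l; rewrite negbK.
Qed.

Lemma segre_neq0 z b : z != 0 -> b != 0 -> segre z b != 0.
Proof.
move=> /row_neq0[l zl] /row_neq0[c bc]; apply/eqP => s0.
have := segreE z b l c; rewrite s0 linear0 mxE => /esym/eqP.
by rewrite mulf_eq0 (negbTE zl) (negbTE bc).
Qed.

End Bihomogeneous.

(** * The birational map onto a product with the projective line *)

Section RulingRuled.
Variables (K : closedFieldType) (N : nat) (Y : set (pspace K N)) (X : set 'rV[K]_N).
Hypothesis Y_closed : pclosed Y.
Hypothesis XY : forall P x, coords P x -> (Y P <-> X x).
Hypothesis primeX : forall p q : {mpoly K[N]}, p \is homog mdeg ->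
  q \is homog mdeg -> p * q = 0 %[on X] -> p = 0 %[on X] \/ q = 0 %[on X].
Variable rl : ruling X.
Implicit Types (x : 'rV[K]_N) (b : 'rV[K]_2).

Local Notation Q := (bdeg rl).
Local Notation M := (N * Q.+1)%N.
Local Notation G := (flat_forms (@zform _ _ _ rl)).
Local Notation d1 := (deg_z rl).
Local Notation d2 := (deg_b rl).

Definition Bform (c : 'I_2) := if c == 0 then b0 rl else b1 rl.

Lemma Bform_homog c : Bform c \is d2.-homog.
Proof. by rewrite /Bform; case: ifP => _; [apply: b0_homog | apply: b1_homog]. Qed.

Lemma G_homog l : G l \is d1.-homog.
Proof. by apply: flat_forms_homog; apply: zform_homog. Qed.

(** The map from Y to the product, in Segre coordinates. *)
Definition phi x : 'rV[K]_(M * 2) := segre (mapply G x) (mapply Bform x).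

Definition psi_coord (j : 'I_N) (z : 'rV[K]_M) (b : 'rV[K]_2) : K :=
  \sum_(q < Q.+1) z 0 (mxvec_index j q) * b 0 1 ^+ q * b 0 0 ^+ (Q - q).

(** The candidate inverse of phi. *)
Definition psi z b : 'rV[K]_N := \row_j psi_coord j z b.

Lemma psi_bihomog j : bihomog 1 Q (psi_coord j).
Proof.
exists (fun q => 'X_(mxvec_index j q)); split=> [q|z b]; first exact: homogXU.
by apply: eq_bigr => q _; rewrite mevalXU.
Qed.

Lemma psiZ c e z b : psi (c *: z) (e *: b) = (c * e ^+ Q) *: psi z b.
Proof.
apply/rowP => j; rewrite !mxE (bihomog_scale _ _ _ _ (psi_bihomog j)) expr1.
by [].
Qed.

Lemma psi_phi x : X x ->
  (w1 rl).@[x 0] *: psi (mapply G x) (mapply Bform x) = (w2 rl).@[x 0] *: x.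
Proof.
move=> Xx; apply/rowP => j; rewrite !mxE.
have := zform_coord rl j Xx; rewrite !mevalM mevalXU => <-; congr (_ * _).
rewrite raddf_sum /=; apply: eq_bigr => q _.
by rewrite !mevalM !rmorphXn /= !mxE /flat_forms mxvecE mxE.
Qed.

(** phi and psi are inverse to each other where this form does not vanish. The
    factor b0 makes its degree positive, so that it vanishes at the origin. *)
Definition T : {mpoly K[N]} := w1 rl * w2 rl * b0 rl.

Lemma T_homog : exists2 d, (0 < d)%N & T \is d.-homog.
Proof.
have /homogP[e he] := w1_homog rl; have /homogP[e' he'] := w2_homog rl.
exists (e + e' + d2)%N; first by rewrite addn_gt0 deg_b_gt0 orbT.
by apply: dhomogM; [apply: dhomogM | apply: b0_homog].
Qed.

Lemma T_homogm : T \is homog mdeg.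
Proof. by apply/homogP; have [d _] := T_homog; exists d. Qed.

Lemma T_neq0 x : T.@[x 0] != 0 -> x != 0.
Proof.
apply: contraNneq => ->; have [d d0 hT] := T_homog.
by rewrite (meval_at0 d0 hT).
Qed.

Lemma T_on : ~ T = 0 %[on X].
Proof.
have /homogP[e he] := w1_homog rl; have /homogP[e' he'] := w2_homog rl.
apply: (neq0_onM primeX); [|by apply/homogP; exists d2; apply: b0_homog| |exact: b0_neq0].
  by apply/homogP; exists (e + e')%N; apply: dhomogM.
by apply: (neq0_onM primeX); rewrite ?w1_homog ?w2_homog //; [apply: w1_neq0|apply: w2_neq0].
Qed.

Lemma TE x : T.@[x 0] != 0 ->
  [/\ (w1 rl).@[x 0] != 0, (w2 rl).@[x 0] != 0 & (b0 rl).@[x 0] != 0].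
Proof. by rewrite !mevalM !mulf_eq0 !negb_or => /andP[/andP[]]. Qed.

Lemma psi_phi_prop x : X x -> T.@[x 0] != 0 ->
  exists2 k, k != 0 & psi (mapply G x) (mapply Bform x) = k *: x.
Proof.
move=> Xx /TE[w1x w2x _].
exists ((w1 rl).@[x 0]^-1 * (w2 rl).@[x 0]); first by rewrite mulf_neq0 ?invr_eq0.
by rewrite -scalerA -psi_phi // scalerA mulVf // scale1r.
Qed.

Lemma phi_neq0 x : X x -> T.@[x 0] != 0 ->
  mapply G x != 0 /\ mapply Bform x != 0.
Proof.
move=> Xx Tx; have [k k0 kx] := psi_phi_prop Xx Tx.
have [_ _ b0x] := TE Tx; split; last first.
  by apply/eqP => /rowP/(_ 0); rewrite !mxE /Bform eqxx => /eqP; rewrite (negbTE b0x).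
apply/eqP => G0; have /negP := T_neq0 Tx; apply; move: kx => /eqP.
rewrite G0 (_ : psi 0 _ = 0) 1?eq_sym ?scaler_eq0 ?(negbTE k0) //.
apply/rowP => j; rewrite !mxE /psi_coord big1 // => q _.
by rewrite mxE !mul0r.
Qed.

(** The closure of the image of Y under the forms zform. *)
Definition Zbar : set (pspace K M) := [set A | forall F, F \is homog mdeg ->
  pullback G F = 0 %[on X] -> vanishes F A].

Lemma X_point x : X x -> x != 0 -> exists2 P, Y P & coords P x.
Proof. by move=> Xx /point_ex[P Px]; exists P => //; apply/(XY Px). Qed.

Lemma Zbar_G x A : X x -> coords A (mapply G x) -> Zbar A.
Proof.
move=> Xx Ax F hF F0; apply/(vanishesE hF Ax).
by rewrite -pullbackE F0 // meval0.
Qed.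

Lemma Zbar_variety : projective_variety Zbar.
Proof.
split.
  exists [set F | F \is homog mdeg /\ pullback G F = 0 %[on X]].
  split=> [F []//|A]; split=> [ZA F [hF F0]|h F hF F0]; first exact: ZA.
  exact: h.
split.
  have [x Xx Tx] : exists2 x, X x & T.@[x 0] != 0.
    apply: contrapT => h; apply: T_on => x Xx; rewrite meval0; apply: contrapT.
    by move=> /eqP Tx; apply: h; exists x.
  have [/point_ex[A Ax] _] := phi_neq0 Xx Tx.
  by exists A; apply: Zbar_G Ax.
move=> Z1 Z2 [S1 [hS1 Z1E]] [S2 [hS2 Z2E]] Z12.
apply: contrapT => /not_orP[nZ1 nZ2].
have pick S (Z' : set (pspace K M)) : (forall F, S F -> F \is homog mdeg) ->
    (forall P, Z' P <-> forall F, S F -> vanishes F P) -> ~ Zbar `<=` Z' ->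
    exists F, [/\ F \is homog mdeg, forall P, Z' P -> vanishes F P &
      ~ pullback G F = 0 %[on X]].
  move=> hS Z'E /existsNP[A /not_implyP[ZA /Z'E/existsNP[F /not_implyP[SF nF]]]].
  exists F; split=> [|P /Z'E|F0]; [exact: hS | exact | apply: nF; apply: ZA => //; exact: hS].
have [F1 [hF1 vF1 nF1]] := pick _ _ hS1 Z1E nZ1.
have [F2 [hF2 vF2 nF2]] := pick _ _ hS2 Z2E nZ2.
have hG F : F \is homog mdeg -> pullback G F \is homog mdeg.
  by move=> /homogP[e he]; apply/homogP; exists (d1 * e)%N; apply: homog_comp => //; apply: G_homog.
have hFF : pullback G F1 * pullback G F2 \is homog mdeg.
  have /homogP[e he] := hG _ hF1; have /homogP[e' he'] := hG _ hF2.
  by apply/homogP; exists (e + e')%N; apply: dhomogM.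
have nFF := neq0_onM primeX (hG _ hF1) (hG _ hF2) nF1 nF2.
(* The zform have a common zero only where T vanishes, hence the factor T. *)
apply: (neq0_onM primeX hFF T_homogm nFF T_on) => x Xx.
rewrite mevalM meval0; have [->|Tx] := eqVneq T.@[x 0] 0; first by rewrite mulr0.
have [/point_ex[A Ax] _] := phi_neq0 Xx Tx.
rewrite mevalM !pullbackE; case: (Z12 _ (Zbar_G Xx Ax)) => [/vF1|/vF2] v.
  by rewrite ((vanishesE hF1 Ax).1 v) !mul0r.
by rewrite ((vanishesE hF2 Ax).1 v) mulr0 mul0r.
Qed.

(** The image of phi is dense in the product: by transcendence of b1 / b0 each
    coefficient vanishes on X after substituting the zform, hence on Zbar.
    Points where T vanishes may be ignored because X is irreducible. *)
Lemma bihomog_dense p r A z b P : bihomog p r A ->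
  (forall x, X x -> T.@[x 0] != 0 -> A (mapply G x) (mapply Bform x) = 0) ->
  Zbar P -> coords P z -> A z b = 0.
Proof.
move=> [H [hH HE]] A0 ZP Pz.
have H0 : \sum_q pullback G (H q) * b1 rl ^+ q * b0 rl ^+ (r - q) = 0 %[on X].
  set F := \sum_q _; have hF : F \is (d1 * p + d2 * r).-homog.
    apply: rpred_sum => q _; have qr : (q <= r)%N by rewrite -ltnS.
    have -> : (d1 * p + d2 * r = d1 * p + d2 * q + d2 * (r - q))%N.
      by rewrite -addnA -mulnDr subnKC.
    apply: dhomogM; last by apply: dhomogMn; apply: b0_homog.
    by apply: dhomogM; [apply: homog_comp => //; apply: G_homog | apply/dhomogMn/b1_homog].
  case: (@primeX F T) => // [||x Xx|/T_on//].
  - by apply/homogP; exists (d1 * p + d2 * r)%N.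
  - exact: T_homogm.
  rewrite mevalM meval0; have [->|Tx] := eqVneq T.@[x 0] 0; first by rewrite mulr0.
  rewrite (_ : F.@[x 0] = 0) ?mul0r // -(A0 x Xx Tx) HE raddf_sum /=.
  apply: eq_bigr => q _; rewrite !mevalM !rmorphXn /= pullbackE.
  by rewrite [mapply Bform x 0 1]mxE [mapply Bform x 0 0]mxE /Bform /=.
rewrite HE big1 // => q _; have := b_transc hH H0 q => /(ZP _ (homogE (hH q))).
by move=> /(_ z Pz) ->; rewrite !mul0r.
Qed.

Lemma psi_form d (F : {mpoly K[N]}) : F \is d.-homog ->
  bihomog (d * 1) (d * Q) (fun z b => F.@[psi z b 0]).
Proof. by move=> hF; apply: bihomog_comp => // j; apply: psi_bihomog. Qed.

(** The equations of Y, pulled back by psi, hold on the image of phi. *)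
Lemma psi_in A z b : Zbar A -> coords A z -> psi z b != 0 -> X (psi z b).
Proof.
move=> ZA Az psi0; have [P Py] := point_ex psi0; apply/(XY Py).
have [S [hS YE]] := Y_closed; apply/YE => F SF.
apply/(vanishesE (hS _ SF) Py); have /homogP[d hF] := hS _ SF.
apply: (bihomog_dense _ (psi_form hF) _ ZA Az) => x Xx Tx.
have [k k0 ->] := psi_phi_prop Xx Tx.
have [R YR Rx] := X_point Xx (T_neq0 Tx).
by rewrite (homog_eval _ _ hF) ((YE R).1 YR F SF x Rx) mulr0.
Qed.

(** Two vectors of forms are proportional when all 2 x 2 minors vanish, and the
    minors are bihomogeneous, so proportionality on the image of phi extends to
    the whole product. *)
Lemma minors_dense M' (E : 'I_M' -> {mpoly K[N]}) d p r (C : 'I_M' -> _) :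
  (forall l, E l \is d.-homog) -> (forall l, bihomog p r (C l)) ->
  (forall l x, C l (mapply G x) (mapply Bform x) = (E l).@[x 0]) ->
  forall l l' A z b, Zbar A -> coords A z ->
  (E l).@[psi z b 0] * C l' z b = (E l').@[psi z b 0] * C l z b.
Proof.
move=> hE hC CE l l' A z b ZA Az.
have h i j := bihomogM (psi_form (hE i)) (hC j).
apply/eqP; rewrite -subr_eq0; apply/eqP; rewrite -mulN1r.
apply: (bihomog_dense _ (bihomogD (h l l') (bihomogZ (-1) (h l' l))) _ ZA Az).
move=> x Xx Tx; have [k k0 ->] := psi_phi_prop Xx Tx.
by rewrite !CE !(homog_eval _ _ (hE _)); ring.
Qed.

Lemma minors_prop M' (u v : 'rV[K]_M') : u != 0 -> v != 0 ->
  (forall l l', u 0 l * v 0 l' = u 0 l' * v 0 l) -> exists2 k, k != 0 & u = k *: v.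
Proof.
move=> u0 v0 uv; have [l vl] := row_neq0 v0.
have uE : u = (u 0 l / v 0 l) *: v.
  by apply/rowP => l'; rewrite mxE mulrAC uv mulfK.
by exists (u 0 l / v 0 l) => //; apply: contra_neq u0 => k0; rewrite uE k0 scale0r.
Qed.

Lemma phi_psi A z b : Zbar A -> coords A z -> b != 0 -> T.@[psi z b 0] != 0 ->
  exists2 k, k != 0 & phi (psi z b) = k *: segre z b.
Proof.
move=> ZA Az b_neq0 Tp; have z_neq0 := coords_neq0 Az.
have Xp := psi_in ZA Az (T_neq0 Tp); have [G0 B0] := phi_neq0 Xp Tp.
have [k k0 kE] : exists2 k, k != 0 & mapply G (psi z b) = k *: z.
  apply: minors_prop => // l l'; rewrite !mxE.
  apply: (minors_dense (C := fun l z _ => z 0 l) (p := 1%N) (r := 0%N) G_homog _ _ _ _ _ ZA Az).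
    move=> i; apply: bihomog_eq (bihomog_form (homogXU K i)) => z' b'.
    by rewrite mevalXU.
  by move=> i x; rewrite mxE.
have [e e0 eE] : exists2 e, e != 0 & mapply Bform (psi z b) = e *: b.
  apply: minors_prop => // l l'; rewrite !mxE.
  apply: (minors_dense (C := fun c _ b => b 0 c) (p := 0%N) (r := 1%N) Bform_homog _ _ _ _ _ ZA Az).
    move=> i; exists (fun q => ((q == i :> nat)%:R)%:MP); split=> [q|z' b'].
      by rewrite -[X in X \is _]mulr1 mul_mpolyC; apply: rpredZ; apply: dhomog1.
    rewrite !big_ord_recl big_ord0 !mevalC /=.
    by case: i => -[|[|//]] i2 /=; rewrite ?mul0r ?mul1r ?mulr1 ?expr0 ?expr1 ?addr0 ?add0r ?mul1r;
      congr (b' 0 _); apply: val_inj.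
  by move=> i x; rewrite mxE.
by exists (k * e); rewrite ?mulf_neq0 // /phi kE eE segreZ.
Qed.


Definition ruling_dom : set (pspace K N) := [set P | Y P /\ ~ vanishes T P].

Definition ruling_cod : set (pspace K (M * 2)) :=
  [set W | exists A z b, [/\ Zbar A, coords A z, b != 0,
    coords W (segre z b) & T.@[psi z b 0] != 0]].

Lemma ruling_dom_coords P x : coords P x -> ruling_dom P ->
  X x /\ T.@[x 0] != 0.
Proof. by move=> Px [/(XY Px) Xx /(not_vanishes T_homogm Px)]. Qed.

Lemma ruling_dom_open : open_in Y ruling_dom.
Proof.
exists [set P | vanishes T P]; split; last by [].
exists [set T]; split=> [F ->|P]; first exact: T_homogm.
by split=> [vP F ->//|]; apply.
Qed.

Lemma ruling_dom_nonempty : ruling_dom !=set0.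
Proof.
have [x Xx Tx] : exists2 x, X x & T.@[x 0] != 0.
  apply: contrapT => h; apply: T_on => x Xx; rewrite meval0; apply: contrapT.
  by move=> /eqP Tx; apply: h; exists x.
have [P YP Px] := X_point Xx (T_neq0 Tx); exists P; split=> //.
exact/(not_vanishes T_homogm Px).
Qed.

Lemma ruling_cod_phi x W : X x -> T.@[x 0] != 0 -> coords W (phi x) ->
  ruling_cod W.
Proof.
move=> Xx Tx Wx; have [/point_ex[A Az] b0] := phi_neq0 Xx Tx.
exists A, (mapply G x), (mapply Bform x); split=> //; first exact: Zbar_G Az.
have [k k0 ->] := psi_phi_prop Xx Tx; have [d _ hT] := T_homog.
by rewrite (homog_eval _ _ hT) mulf_neq0 ?expf_neq0.
Qed.

Lemma ruling_cod_open : open_in (segre_product Zbar [set: pspace K 2]) ruling_cod.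
Proof.
have [d d_gt0 hT] := T_homog.
pose F_ok (F : {mpoly K[M * 2]}) := F \is homog mdeg /\ exists l c,
  forall y : 'rV[K]_(M * 2), F.@[y 0] = T.@[psi (scol c y) (srow l y) 0].
exists [set W | forall F, F_ok F -> vanishes F W]; split.
  by exists F_ok; split=> [F []|].
apply/funext => W; apply/propext; split.
  move=> [A [z [b [ZA Az b_neq0 Wzb Tzb]]]]; split.
    have [B Bb] := point_ex b_neq0; exists A, B; split=> // a' b' Aa' Bb'.
    have [k k0 ->] := coords_prop Az Aa'; have [e e0 ->] := coords_prop Bb Bb'.
    by rewrite -/(segre _ _) segreZ; apply: coordsZ => //; apply: mulf_neq0.
  have [l zl] := row_neq0 (coords_neq0 Az); have [c bc] := row_neq0 b_neq0.
  have [F hF FE] := bihomog_segre l c (psi_form hT).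
  move=> vW; have := vW F (conj (homogE hF) (ex_intro _ l (ex_intro _ c FE))).
  apply/(not_vanishes (homogE hF) Wzb).
  by rewrite FE scol_segre srow_segre psiZ (homog_eval _ _ hT) !(mulf_neq0, expf_neq0).
move=> -[sW nW]; have [A [B [ZA _ WAB]]] := sW.
have [z Az] := coords_ex A; have [b Bb] := coords_ex B.
exists A, z, b; split=> //; [exact: coords_neq0 Bb | exact: WAB |].
apply/eqP => T0; apply: nW => F [hF [l [c FE]]].
apply/(vanishesE hF (WAB _ _ Az Bb)).
by rewrite FE scol_segre srow_segre psiZ (homog_eval _ _ hT) T0 mulr0.
Qed.

(** phi and psi are each defined on coordinates only, so the maps on points are
    first extracted from their effect on all coordinate vectors. Locally psi is
    computed from a row and a column of the Segre matrix meeting in a nonzero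
    entry. *)
Lemma ruling_isomorphic : isomorphic ruling_dom ruling_cod.
Proof.
have /choice[f fP] (P : ruling_dom) : exists W : ruling_cod,
    forall x, coords (val P) x -> coords (val W) (phi x).
  have [x Px] := coords_ex (val P).
  have [Xx Tx] := ruling_dom_coords Px (set_valP P).
  have [G0 B0] := phi_neq0 Xx Tx; have [W Wx] := point_ex (segre_neq0 G0 B0).
  exists (SigSub (mem_set (ruling_cod_phi Xx Tx Wx))) => x' Px'.
  have [k k0 ->] := coords_prop Px Px'.
  rewrite /phi (mapplyZ _ _ G_homog) (mapplyZ _ _ Bform_homog) segreZ.
  by apply: coordsZ => //; rewrite mulf_neq0 ?expf_neq0.
have psi_point W : ruling_cod W -> exists P, ruling_dom P /\
    forall y l c, coords W y -> vec_mx y l c != 0 ->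
      coords P (psi (scol c y) (srow l y)).
  move=> [A [z [b [ZA Az b_neq0 Wzb Tzb]]]].
  have [P Pp] := point_ex (T_neq0 Tzb); exists P; split.
    split; last by apply/(not_vanishes T_homogm Pp).
    by apply/(XY Pp); apply: psi_in ZA Az (T_neq0 Tzb).
  move=> y l c Wy; have [k k0 ->] := coords_prop Wzb Wy.
  rewrite linearZ mxE segreE !mulf_eq0 !negb_or => /and3P[_ zl bc].
  rewrite scolZ srowZ scol_segre srow_segre !scalerA psiZ.
  by apply: coordsZ => //; rewrite !(mulf_neq0, expf_neq0).
have /choice[g gP] (W : ruling_cod) : exists P : ruling_dom,
    forall y l c, coords (val W) y -> vec_mx y l c != 0 ->
      coords (val P) (psi (scol c y) (srow l y)).
  have [P [PU hP]] := psi_point _ (set_valP W).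
  by exists (SigSub (mem_set PU)).
exists f, g; split.
- move=> P; apply: val_inj; have [x Px] := coords_ex (val P).
  have [Xx Tx] := ruling_dom_coords Px (set_valP P).
  have [G0 B0] := phi_neq0 Xx Tx.
  have [[l Gl] [c Bc]] := (row_neq0 G0, row_neq0 B0).
  have := gP (f P) _ l c (fP P x Px); rewrite segreE mulf_neq0 // => /(_ isT).
  rewrite scol_segre srow_segre psiZ; have [k k0 ->] := psi_phi_prop Xx Tx.
  rewrite scalerA => gfx; apply: coords_inj gfx _; apply: coordsZ => //.
  by rewrite !(mulf_neq0, expf_neq0).
- move=> W; apply: val_inj.
  have [A [z [b [ZA Az b_neq0 Wzb Tzb]]]] := set_valP W.
  have [l zl] := row_neq0 (coords_neq0 Az); have [c bc] := row_neq0 b_neq0.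
  have := gP W _ l c Wzb; rewrite segreE mulf_neq0 // => /(_ isT).
  rewrite scol_segre srow_segre psiZ; set e := _ * _ => gWe.
  have e0 : e != 0 by rewrite !(mulf_neq0, expf_neq0).
  have gW : coords (val (g W)) (psi z b).
    by rewrite -(scalerK e0 (psi z b)); apply: coordsZ; rewrite ?invr_eq0.
  have := fP _ _ gW; have [k k0 ->] := phi_psi ZA Az b_neq0 Tzb.
  by move=> h; apply: coords_inj h _; apply: coordsZ.
- move=> P; exists 1, (d1 + d2)%N.
  exists (flat_forms (fun l c => G l * Bform c)); split.
  + by apply/homogP; exists 0%N; apply: dhomog1.
  + have [x Px] := coords_ex (val P); move=> /(_ x Px).
    by rewrite meval1; apply/eqP; apply: oner_neq0.
  + by apply: flat_forms_homog => l c; apply: dhomogM; [apply: G_homog | apply: Bform_homog].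
  + move=> P' x _ Px; have := fP P' x Px; congr coords; apply/rowP => t.
    case/mxvec_indexP: t => l c; rewrite mxvecE !mxE big_ord1 /flat_forms mxvecE.
    by rewrite !mxE mevalM.
- move=> W; have [y Wy] := coords_ex (val W).
  have [l [c ylc]] : exists l c, vec_mx y l c != 0.
    have [t yt] := row_neq0 (coords_neq0 Wy); move: yt.
    by case/mxvec_indexP: t => l c ylc; exists l, c; rewrite mxE.
  have /choice[F FP] (j : 'I_N) : exists F : {mpoly K[M * 2]}, F \is (1 + Q).-homog /\
      forall y : 'rV[K]_(M * 2), F.@[y 0] = psi_coord j (scol c y) (srow l y).
    by have [F hF FE] := bihomog_segre l c (psi_bihomog j); exists F.
  have hX : ('X_(mxvec_index l c) : {mpoly K[M * 2]}) \is homog mdeg.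
    by apply/homogP; exists 1%N; apply: homogXU.
  have XE (y' : 'rV[K]_(M * 2)) : ('X_(mxvec_index l c)).@[y' 0] = vec_mx y' l c.
    by rewrite mevalXU mxE.
  exists 'X_(mxvec_index l c), (1 + Q)%N, F; split=> //.
  + by apply/(not_vanishes hX Wy); rewrite XE.
  + by move=> j; have [] := FP j.
  + move=> W' y' nW Wy'; have := gP W' y' l c Wy'.
    move: nW => /(not_vanishes hX Wy'); rewrite XE => y'lc /(_ y'lc).
    by congr coords; apply/rowP => j; rewrite !mxE; have [_ ->] := FP j.
Qed.

Theorem ruling_birational : exists Z : set (pspace K M),
  projective_variety Z /\ birational Y (segre_product Z [set: pspace K 2]).
Proof.
exists Zbar; split; first exact: Zbar_variety.
exists ruling_dom, ruling_cod; split.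
- exact: ruling_dom_open.
- exact: ruling_dom_nonempty.
- exact: ruling_cod_open.
- have [P PU] := ruling_dom_nonempty; have [x Px] := coords_ex P.
  have [Xx Tx] := ruling_dom_coords Px PU; have [G0 B0] := phi_neq0 Xx Tx.
  have [W Wx] := point_ex (segre_neq0 G0 B0).
  by exists W; apply: ruling_cod_phi Wx.
- exact: ruling_isomorphic.
Qed.

End RulingRuled.

(** * The vector field of a conjugate of the scaling action *)

Section Flow.
Variables (K : closedFieldType) (N : nat) (X : set 'rV[K]_N).
Hypothesis char0 : forall m, m.+1%:R != 0 :> K.
Hypothesis coneX : forall c x, X x -> X (c *: x).
Hypothesis primeX : forall p q : {mpoly K[N]}, p \is homog mdeg ->
  q \is homog mdeg -> p * q = 0 %[on X] -> p = 0 %[on X] \/ q = 0 %[on X].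
Hypothesis X_not_line : ~ exists v : 'rV[K]_N, forall x, X x -> exists t, x = t *: v.
Variables F F' : 'I_N -> {mpoly K[N]}.
Hypothesis FX : forall x, X x -> X (mapply F x).
Hypothesis F'X : forall x, X x -> X (mapply F' x).
Hypothesis FK : forall x, X x -> mapply F' (mapply F x) = x.
Hypothesis F'K : forall x, X x -> mapply F (mapply F' x) = x.
Implicit Types (p q r : {mpoly K[N]}) (x : 'rV[K]_N).

Local Notation euler := (lie (fun i => 'X_i)).

Lemma homog_msize_le p d : p \is d.-homog -> (msize p <= d.+1)%N.
Proof.
move=> /dhomogP hp; rewrite msizeE; apply/bigmax_leqP_seq => m /hp /= -> _.
exact: leqnn.
Qed.

Lemma msize_sum_le (I : Type) (s : seq I) (f : I -> {mpoly K[N]}) k :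
  (forall i, (msize (f i) <= k)%N) -> (msize (\sum_(i <- s) f i) <= k)%N.
Proof.
move=> fk; elim/big_ind: _ => [|p q pk qk|//]; first by rewrite mmeasure0.
by apply: leq_trans (mmeasureD_le _ _ _) _; rewrite geq_max pk qk.
Qed.

Lemma euler_sum p k : (msize p <= k)%N ->
  euler p = \sum_(d < k) d%:R *: pihomog mdeg d p.
Proof.
move=> pk; rewrite {1}(homog_split pk) linear_sum /=; apply: eq_bigr => d _.
by rewrite (@euler_homog _ _ _ d) // pihomogP.
Qed.

Lemma pihomog_sum (c : nat -> {mpoly K[N]}) k d :
  (forall e, c e \is e.-homog) -> (d < k)%N ->
  pihomog mdeg d (\sum_(e < k) c e) = c d.
Proof.
move=> hc dk; rewrite linear_sum /= (bigD1 (Ordinal dk)) //= big1 ?addr0.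
  exact: pihomog_dE.
by move=> e ed; apply: pihomog_ne0 (hc e).
Qed.

Lemma pihomog_msize p d : (msize p <= d)%N -> pihomog mdeg d p = 0.
Proof.
move=> pd; rewrite (homog_split pd) linear_sum big1 //= => e _.
by apply: pihomog_ne0 (pihomogP _ _ _); rewrite ltn_eqF.
Qed.

Lemma euler_on p : p = 0 %[on X] -> euler p = 0 %[on X].
Proof.
move=> p0 x Xx; rewrite (euler_sum (leqnn _)) raddf_sum /= big1 ?meval0 // => d _.
by rewrite mevalZ (pihomog_on0 coneX d p0 Xx) meval0 mulr0.
Qed.

Lemma pullback_on p q : p = q %[on X] -> pullback F p = pullback F q %[on X].
Proof. by move=> pq x Xx; rewrite !pullbackE pq //; apply: FX. Qed.

Lemma pullbackK p : pullback F (pullback F' p) = p %[on X].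
Proof. by move=> x Xx; rewrite !pullbackE FK. Qed.

Lemma pullbackK' p : pullback F' (pullback F p) = p %[on X].
Proof. by move=> x Xx; rewrite !pullbackE F'K. Qed.

(** The velocity at x of the curve t |-> F'(t F(x)) at t = 1. *)
Definition flow i := pullback F (euler (F' i)).

(** Both sides are derivations modulo the ideal of X; they agree on the
    variables. *)
Lemma lie_flow p : lie flow p = pullback F (euler (pullback F' p)) %[on X].
Proof.
elim/mpoly_ring_ind: p => [c|i|p q IHp IHq|p q IHp IHq] x Xx.
- by rewrite pullbackC !lieC pullbackE !meval0.
- by rewrite lieX pullbackX.
- rewrite linearD mevalD [X in X + _](IHp x Xx) [X in _ + X](IHq x Xx).
  by rewrite -mevalD -pullbackD -linearD -pullbackD.
rewrite lieM mevalD !mevalM IHp // IHq // pullbackM lieM pullbackD !pullbackM.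
by rewrite mevalD !mevalM [in RHS]pullbackK // [in RHS]pullbackK.
Qed.

Lemma flow_on p : p = 0 %[on X] -> lie flow p = 0 %[on X].
Proof.
move=> p0 x Xx; rewrite lie_flow // pullbackE meval0.
have e0 : euler (pullback F' p) = 0 %[on X].
  by apply: euler_on => y Xy; rewrite pullbackE p0 ?meval0 //; apply: F'X.
by rewrite e0 ?meval0 //; apply: FX.
Qed.

(** After pulling back by F' the derivation becomes the Euler derivation, which
    multiplies the part of degree d by d. *)
Lemma iter_lie_flow p k j : (msize (pullback F' p) <= k)%N ->
  iter j (lie flow) p =
    \sum_(d < k) (d ^ j)%:R *: pullback F (pihomog mdeg d (pullback F' p)) %[on X].
Proof.
move=> qk; set q := pullback F' p in qk *.
have H : iter j (lie flow) p =
    pullback F (\sum_(d < k) (d ^ j)%:R *: pihomog mdeg d q) %[on X].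
  elim: j => [|j IH] x Xx.
    rewrite /= (eq_bigr (fun d : 'I_k => pihomog mdeg d q)).
      by rewrite -homog_split // pullbackK.
    by move=> d _; rewrite expn0 scale1r.
  rewrite iterS (lie_on flow_on IH Xx) lie_flow //.
  rewrite (pullback_on (q := \sum_(d < k) (d ^ j.+1)%:R *: pihomog mdeg d q)) //.
  move=> y Xy; set w := \sum_(d < k) (d ^ j)%:R *: _.
  have -> : (euler (pullback F' (pullback F w))).@[y 0] = (euler w).@[y 0].
    exact: (lie_on euler_on (@pullbackK' w)).
  congr (_.@[y 0]); rewrite linear_sum; apply: eq_bigr => d _.
  rewrite linearZ /= (@euler_homog _ _ _ d) ?pihomogP // scalerA -natrM.
  by rewrite -expnSr.
move=> x Xx; rewrite H // pullback_sum; congr (_.@[x 0]).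
by apply: eq_bigr => d _; rewrite pullbackZ.
Qed.

(** Local finiteness of the derivation along the flow, in the form of a degree
    bound. *)
Lemma iter_lie_flow_bounded p : exists n0, forall j, exists2 r,
  (msize r <= n0)%N & iter j (lie flow) p = r %[on X].
Proof.
set k := msize (pullback F' p).
exists (\max_(d < k) msize (pullback F (pihomog mdeg d (pullback F' p)))) => j.
eexists; last exact: (iter_lie_flow j (leqnn k)).
apply: msize_sum_le => d; apply: leq_trans (msizeZ_le _ _) _.
exact: (leq_bigmax d).
Qed.

Definition flow_part k i := pihomog mdeg k (flow i).

Lemma flow_part_homog k i : flow_part k i \is k.-homog.
Proof. exact: pihomogP. Qed.

Let kappa := (\max_i msize (flow i))%N.

Lemma flow_part_big k i : (kappa <= k)%N -> flow_part k i = 0.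
Proof.
move=> h; apply: pihomog_msize; apply: leq_trans h.
exact: (leq_bigmax (F := fun i => msize (flow i)) i).
Qed.

Lemma lie_parts p : lie flow p = \sum_(k < kappa) lie (flow_part k) p.
Proof.
rewrite exchange_big; apply: eq_bigr => i _; rewrite -mulr_sumr; congr (_ * _).
by apply: homog_split; apply: (leq_bigmax (F := fun i => msize (flow i)) i).
Qed.

(** The ideal of X is homogeneous and the parts of the vector field shift
    degrees by different amounts. *)
Lemma flow_part_on k p : p = 0 %[on X] -> lie (flow_part k) p = 0 %[on X].
Proof.
have [kk|kk] := leqP kappa k.
  move=> _ x _; rewrite /lie big1 // => i _; first by rewrite flow_part_big // mulr0.
move=> p0 x Xx; rewrite (homog_split (leqnn (msize p))) [lie _ _]linear_sum raddf_sum meval0.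
rewrite big1 // => -[d /= _] _; set q := pihomog mdeg d p.
have hq : q \is d.-homog by apply: pihomogP.
have q0 : q = 0 %[on X] by apply: pihomog_on0.
case: d @q hq q0 => [|d] q hq q0; first by rewrite (homog0_const hq) lieC meval0.
(* q has degree d + 1, so the k-th part of the field sends it to degree d + k. *)
pose c e := if (d <= e)%N then lie (flow_part (e - d)) q else 0.
have cE e : c (d + e)%N = lie (flow_part e) q by rewrite /c leq_addr addKn.
have hc e : c e \is e.-homog.
  rewrite /c; case: leqP => [de|_]; last exact: dhomog0.
  by have := lie_homog (flow_part_homog (e - d)) hq; rewrite addSn subnKC.
have c0 : \sum_(e < d + kappa) c e = 0 %[on X].
  move=> y Xy; rewrite big_split_ord /= big1 => [|e _].
    rewrite add0r (eq_bigr (fun k : 'I_kappa => lie (flow_part k) q)) => [|e _].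
      by rewrite -lie_parts flow_on.
    by rewrite cE.
  by rewrite /c leqNgt ltn_ord.
have := eq_on_homog_sum coneX (fun e _ => hc e) c0 (d := (d + k)%N).
by rewrite ltn_add2l cE => /(_ kk x Xx) /= ->; rewrite ?meval0.
Qed.

Lemma msize_lie (v : 'I_N -> {mpoly K[N]}) k p : (forall i, v i \is k.-homog) ->
  (msize (lie v p) <= maxn 1 (msize p + k).-1)%N.
Proof.
move=> hv; rewrite [in X in (X <= _)%N](homog_split (leqnn (msize p))) linear_sum /=.
apply: msize_sum_le => -[d /= dp].
have := homog_msize_le (lie_homog hv (pihomogP mdeg d p)).
by move/leq_trans; apply; lia.
Qed.

(** For p homogeneous of degree d, iter j D p is the part of highest possible
    degree d + j (k - 1) in the j-th iterate along the whole flow, whose degree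
    stays bounded in j; so it vanishes on X for large j. *)
Lemma flow_top_nilp k : (1 < k)%N ->
  (forall k' i, (k < k')%N -> flow_part k' i = 0 %[on X]) ->
  forall p d, p \is d.-homog ->
  exists j, iter j (lie (flow_part k)) p = 0 %[on X].
Proof.
move=> k1 top p d hp; set D := lie (flow_part k).
have lieE q : lie flow q = \sum_(k' < k.+1) lie (flow_part k') q %[on X].
  move=> x Xx; set m := (kappa + k.+1)%N.
  have -> : lie flow q = \sum_(k' < m) lie (flow_part k') q.
    rewrite big_split_ord /= -lie_parts [X in _ + X]big1 ?addr0 // => i _.
    by rewrite /lie big1 // => l _; rewrite flow_part_big ?mulr0 // leq_addr.
  rewrite /m addnC big_split_ord /= mevalD [X in _ + X](_ : _ = 0) ?addr0 //.
  rewrite raddf_sum big1 // => i _; rewrite /lie raddf_sum big1 // => l _.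
  by rewrite /= mevalM top ?meval0 ?mulr0 // leq_addr.
have expand j : exists2 r, (msize r <= d + j * k.-1)%N &
    iter j (lie flow) p = iter j D p + r %[on X].
  elim: j => [|j [r hr IH]]; first by exists 0; rewrite ?mmeasure0 //= addr0.
  exists (\sum_(k' < k) lie (flow_part k') (iter j D p) +
          \sum_(k' < k.+1) lie (flow_part k') r).
    have le_k : (0 < d + j.+1 * k.-1)%N by rewrite addn_gt0 muln_gt0; lia.
    have jk : (d + j.+1 * k.-1 = d + j * k.-1 + k.-1)%N by rewrite mulSn; lia.
    apply: leq_trans (mmeasureD_le _ _ _) _; rewrite geq_max; apply/andP; split.
      apply: msize_sum_le => k'; apply: leq_trans (msize_lie _ (flow_part_homog k')) _.
      rewrite geq_max le_k /=; have k'k := ltn_ord k'.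
      have [->|[e he ej]] := iter_lie_homog (flow_part_homog k) j hp.
        by rewrite mmeasure0; lia.
      have := homog_msize_le he; rewrite -/D => he'.
      have : (j * k = j * k.-1 + j)%N by rewrite -mulnSr prednK //; lia.
      by lia.
    apply: msize_sum_le => k'; apply: leq_trans (msize_lie _ (flow_part_homog k')) _.
    by rewrite geq_max le_k /=; have k'k := ltn_ord k'; lia.
  move=> x Xx; rewrite !iterS (lie_on flow_on IH Xx) [lie flow _]linearD [LHS]mevalD /=.
  rewrite [X in X + _](lieE _ x Xx) [X in _ + X](lieE _ x Xx) big_ord_recr /=.
  by rewrite !mevalD addrCA addrA.
have [n0 bound] := iter_lie_flow_bounded p.
(* As k - 1 > 0, the degree d + j (k - 1) exceeds the bound at j = n0. *)
exists n0; have [r hr rE] := bound n0; have [r' hr' r'E] := expand n0.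
have [->//|[e he en]] := iter_lie_homog (flow_part_homog k) n0 hp.
have kk : (n0 * k = n0 * k.-1 + n0)%N by rewrite -mulnSr prednK //; lia.
have n0k : (n0 <= n0 * k.-1)%N by apply: leq_pmulr; lia.
have diff0 : iter n0 D p - (r - r') = 0 %[on X].
  move=> x Xx; rewrite !mevalB -rE // r'E // mevalD meval0; ring.
move=> x Xx; have := pihomog_on0 coneX e diff0 Xx.
rewrite linearB /= (pihomog_dE he) [pihomog _ _ (r - r')]pihomog_msize ?subr0 //.
apply: leq_trans (mmeasureD_le _ _ _) _; rewrite mmeasureN geq_max; lia.
Qed.

Lemma meval_at0_part r :
  r.@[(0 : 'rV[K]_N) 0] = (pihomog mdeg 0 r).@[(0 : 'rV[K]_N) 0].
Proof.
rewrite {1}(homog_split (leqnSn (msize r))) big_ord_recl [LHS]mevalD.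
rewrite [X in _ + X]raddf_sum [X in _ + X]big1 ?addr0 // => i _.
by rewrite /= (meval_at0 (d := bump 0 i)) // pihomogP.
Qed.

Lemma pihomog1M p q : p.@[(0 : 'rV[K]_N) 0] = 0 -> q.@[(0 : 'rV[K]_N) 0] = 0 ->
  pihomog mdeg 1 (p * q) = 0.
Proof.
have part0 r : r.@[(0 : 'rV[K]_N) 0] = 0 -> pihomog mdeg 0 r = 0.
  move=> r0; have h0 := homog0_const (pihomogP mdeg 0 r).
  by have := meval_at0_part r; rewrite r0 h0 mevalC => <-; rewrite mpolyC0.
move=> /part0 p0 /part0 q0.
rewrite (homog_split (leqnn (msize p))) (homog_split (leqnn (msize q))).
rewrite mulr_suml linear_sum big1 // => -[d /= _] _.
rewrite mulr_sumr linear_sum big1 // => -[e /= _] _.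
case: d => [|d]; first by rewrite p0 mul0r linear0.
case: e => [|e]; first by rewrite q0 mulr0 linear0.
apply: (pihomog_ne0 (d := (d.+1 + e.+1)%N)); first by lia.
by apply: dhomogM; apply: pihomogP.
Qed.

Section LinearFlow.
Hypothesis parts : forall k i, k != 1%N -> flow_part k i = 0 %[on X].

(** A linear field preserves degrees, and F j is an eigenvector of eigenvalue 1
    since it becomes the variable 'X_j after pullback by F'. So are its parts,
    and the Euler derivation has eigenvalue 1 only in degree 1. *)
Lemma pullback_part_linear j m :
  let g := pullback F' (pihomog mdeg m (F j)) in g = pihomog mdeg 1 g %[on X].
Proof.
have lieE q : lie flow q = lie (flow_part 1) q %[on X].
  move=> x Xx; rewrite /lie !raddf_sum; apply: eq_bigr => i _.
  rewrite /= !mevalM; congr (_ * _).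
  rewrite {1}(homog_split (leq_addl 2 (msize (flow i)))) raddf_sum /=.
  rewrite (sum_one (f := fun d => (pihomog mdeg d (flow i)).@[x 0]) (i1 := 1%N)) // => d d1.
  by have := parts i d1 Xx; rewrite meval0.
have lieF : lie flow (F j) = F j %[on X].
  move=> x Xx; rewrite lie_flow //.
  have FjX : pullback F' (F j) = 'X_j %[on X].
    by move=> y Xy; rewrite pullbackE mevalXU -[in RHS](F'K Xy) mxE.
  by rewrite (pullback_on (lie_on euler_on FjX)) // lieX pullbackX.
set P := pihomog mdeg m (F j).
have lieP : lie flow P = P %[on X].
  move=> x Xx; rewrite lieE //; apply/eqP; rewrite -subr_eq0 -mevalB.
  have comm : lie (flow_part 1) P = pihomog mdeg m (lie (flow_part 1) (F j)).
    have hc e : lie (flow_part 1) (pihomog mdeg e (F j)) \is e.-homog.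
      by have := lie_homog (flow_part_homog 1) (pihomogP mdeg e (F j)); rewrite addn1.
    rewrite [in RHS](homog_split (leq_maxl (msize (F j)) m.+1)).
    rewrite [lie _ (\sum_(_ < _) _)]linear_sum.
    by apply/esym/(pihomog_sum hc); rewrite leq_maxr.
  have diff0 : lie (flow_part 1) (F j) - F j = 0 %[on X].
    by move=> y Xy; rewrite mevalB -lieE // lieF // subrr meval0.
  by rewrite comm -linearB /= (pihomog_on0 coneX m diff0 Xx) meval0.
move=> g.
  have eg : euler g - g = 0 %[on X].
    move=> y Xy; rewrite mevalB meval0; apply/eqP; rewrite subr_eq0; apply/eqP.
    have := lieP _ (F'X Xy); rewrite (lie_flow _ (F'X Xy)) pullbackE F'K //.
    by rewrite -pullbackE.
  move=> x Xx; rewrite {1}(homog_split (leq_addl 2 (msize g))) raddf_sum /=.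
  rewrite (sum_one (f := fun d => (pihomog mdeg d g).@[x 0]) (i1 := 1%N)) // => d d1.
  have := pihomog_on0 coneX d eg Xx; set k := maxn (msize g) d.+1.
  rewrite linearB /= (euler_sum (leq_maxl _ d.+1)).
  have hc e : e%:R *: pihomog mdeg e g \is e.-homog.
    by apply: rpredZ; apply: pihomogP.
  rewrite [pihomog _ _ (\sum_(_ < _) _)](pihomog_sum hc) ?leq_maxr //.
  rewrite mevalB mevalZ meval0 => /eqP.
  rewrite -{2}[_.@[_]]mul1r -mulrBl mulf_eq0 => /orP[|/eqP //].
  case: d d1 {k} => [|[|d]] //= _; first by rewrite sub0r oppr_eq0 oner_eq0.
  by rewrite -[1]/(1%:R) -natrB // subSS subn0 (negbTE (char0 _)).
Qed.

Lemma const_part j x : X x -> (pihomog mdeg 0 (F j)).@[x 0] = 0.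
Proof.
move=> Xx; have hP := homog0_const (pihomogP mdeg 0 (F j)).
have := @pullback_part_linear j 0%N 0; rewrite -{1}(scale0r x) => /(_ (coneX 0 Xx)).
rewrite [RHS](meval_at0 (d := 1%N)) ?pihomogP // hP pullbackC mevalC.
by move=> ->; rewrite mpolyC0 meval0.
Qed.

(** F' fixes the vertex, so pulling back a form of degree at least 2 gives a
    polynomial without linear part; being equal to its linear part on X, it
    vanishes there. Euler's identity writes such a form as a sum of products of
    two factors vanishing at the vertex. *)
Lemma flow_linear j : F j = pihomog mdeg 1 (F j) %[on X].
Proof.
have P0 m : m != 1%N -> pihomog mdeg m (F j) = 0 %[on X].
  case: m => [_|[//|m _]] x Xx; first by rewrite const_part // meval0.
  have X0 : X 0 by rewrite -(scale0r x); apply: coneX.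
  have F'0 : mapply F' 0 = 0.
    rewrite -[RHS](FK X0); congr (mapply F' _); apply/rowP => i.
    by rewrite !mxE meval_at0_part const_part.
  set P := pihomog mdeg m.+2 (F j).
  suff g0 : pihomog mdeg 1 (pullback F' P) = 0.
    by have := pullback_part_linear j m.+2 (FX Xx); rewrite -/P g0 pullbackE FK ?meval0.
  have hP : P \is m.+2.-homog by apply: pihomogP.
  rewrite -[P](scalerK (char0 m.+1)) -(euler_homog hP) /lie.
  rewrite pullbackZ pullback_sum linearZ /= [pihomog _ _ _]linear_sum big1 ?scaler0 // => i _.
  rewrite /= pullbackM pullbackX pihomog1M //.
    by rewrite pullbackE F'0 (meval_at0 _ (mderiv_homog i hP)).
  by have /rowP/(_ i) := F'0; rewrite !mxE.
move=> x Xx; rewrite {1}(homog_split (leq_addl 2 (msize (F j)))) raddf_sum /=.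
rewrite (sum_one (f := fun d => (pihomog mdeg d (F j)).@[x 0]) (i1 := 1%N)) // => d d1.
by rewrite P0 // meval0.
Qed.

End LinearFlow.

Theorem ruling_or_linear :
  (exists _ : ruling X, True) \/ forall j, F j = pihomog mdeg 1 (F j) %[on X].
Proof.
have [parts|] := pselect (forall k i, k != 1%N -> flow_part k i = 0 %[on X]).
  by right; apply: flow_linear.
move=> nparts; left.
have [nz|z0] := pselect (exists i, ~ flow_part 0 i = 0 %[on X]).
  apply: (ruling_of_derivation char0 primeX X_not_line (flow_part_homog 0)).
  - exact: flow_part_on.
  - move=> p d _; have [j pj] := lie_const_nilp p (flow_part_homog 0).
    by exists j; rewrite pj.
  - by move=> h; case: nz => i; apply.
have ex_k : exists k, `[< exists i, ~ flow_part k i = 0 %[on X] >].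
  apply: contrapT => h; apply: nparts => k i _; apply: contrapT => hk.
  by apply: h; exists k; apply/asboolP; exists i.
have bound k : `[< exists i, ~ flow_part k i = 0 %[on X] >] -> (k <= kappa)%N.
  move=> /asboolP[i hi]; rewrite leqNgt; apply/negP => hk; apply: hi.
  by rewrite flow_part_big // ltnW.
case: (ex_maxnP ex_k bound) => k /asboolP[i hi] maxk.
have top k' i' : (k < k')%N -> flow_part k' i' = 0 %[on X].
  move=> kk'; apply: contrapT => h; have := maxk k'.
  by rewrite leqNgt kk' => /(_ (asboolT (ex_intro _ i' h))).
have k1 : (1 < k)%N.
  rewrite ltnNge; apply/negP => k_le1; apply: nparts => k' i' k'1.
  apply: contrapT => h; case: k' k'1 h => [_ h|[//|k'] _ h]; first by apply: z0; exists i'.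
  by apply: h; apply: top; lia.
apply: (ruling_of_derivation char0 primeX X_not_line (flow_part_homog k)).
- exact: flow_part_on.
- exact: flow_top_nilp.
- by move=> h; apply: hi.
Qed.

End Flow.

(** * The affine cone and its linear automorphisms *)

Section Cone.
Variables (K : closedFieldType) (N : nat) (Y : set (pspace K N)).
Hypothesis Y_variety : projective_variety Y.
Local Notation X := (affine_cone Y).

Lemma cone_form F x : F \is homog mdeg -> (forall P, Y P -> vanishes F P) ->
  X x -> F.@[x 0] = 0.
Proof.
move=> hF vF Xx; apply: Xx; exists 1%N, (fun=> 1), (fun=> F); split=> //.
by rewrite big_ord1 mul1r.
Qed.

Lemma cone_coords P x : coords P x -> (Y P <-> X x).
Proof.
move=> Px; split=> [YP p [k [a [F [hF ->]]]]|Xx].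
  rewrite raddf_sum big1 // => i _; rewrite /= mevalM.
  by rewrite ((hF i).2 P YP x Px) mulr0.
have [[S [hS YE]] _] := Y_variety; apply/YE => F SF.
apply/(vanishesE (hS _ SF) Px); apply: cone_form Xx; first exact: hS.
by move=> Q /YE; apply.
Qed.

Lemma coneZ c x : X x -> X (c *: x).
Proof.
move=> Xx p [k [a [F [hF ->]]]]; rewrite raddf_sum big1 // => i _ /=.
have [hFi vFi] := hF i; have /homogP[d hd] := hFi.
by rewrite mevalM (homog_eval _ _ hd) (cone_form hFi vFi Xx) !mulr0.
Qed.

Lemma cone_point : exists2 y, X y & y != 0.
Proof.
have [_ [[P YP] _]] := Y_variety; have [y Py] := coords_ex P.
by exists y; [apply/(cone_coords Py) | apply: coords_neq0 Py].
Qed.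

Lemma cone0 : X 0.
Proof. by have [y Xy _] := cone_point; rewrite -(scale0r y); apply: coneZ. Qed.

Lemma cone_neq0 x : X x -> x != 0 -> exists2 P, Y P & coords P x.
Proof. by move=> Xx /point_ex[P Px]; exists P => //; apply/(cone_coords Px). Qed.

Lemma cone_prime (p q : {mpoly K[N]}) : p \is homog mdeg -> q \is homog mdeg ->
  p * q = 0 %[on X] -> p = 0 %[on X] \/ q = 0 %[on X].
Proof.
move=> hp hq pq0; have [_ [_ irr]] := Y_variety.
have closed F : F \is homog mdeg -> pclosed [set P : pspace K N | vanishes F P].
  move=> hF; exists [set F]; split=> [G -> //|P].
  by split=> [vP G -> //|]; apply.
have van F : F \is homog mdeg -> Y `<=` [set P | vanishes F P] -> F = 0 %[on X].
  move=> hF vF; have nz x : X x -> x != 0 -> F.@[x 0] = 0.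
    by move=> Xx /(cone_neq0 Xx)[P YP Px]; apply: (vF P YP x Px).
  move=> x Xx; rewrite meval0; have [->|] := eqVneq x 0; last exact: nz.
  have [y Xy y0] := cone_point; have /homogP[d hd] := hF.
  by rewrite -(scale0r y) (homog_eval _ _ hd) nz ?mulr0.
case: (irr _ _ (closed p hp) (closed q hq)) => [P YP|/(van _ hp)|/(van _ hq)].
- have [x Px] := coords_ex P; have Xx := (cone_coords Px).1 YP.
  have /eqP := pq0 x Xx; rewrite meval0 mevalM mulf_eq0 => /orP[]/eqP h.
    by left; apply: ((vanishesE hp Px).2 h).
  by right; apply: ((vanishesE hq Px).2 h).
- by left.
- by right.
Qed.

Lemma cone_not_line : (exists P Q, [/\ Y P, Y Q & P <> Q]) ->
  ~ exists v : 'rV[K]_N, forall x, X x -> exists t, x = t *: v.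
Proof.
move=> [P [Q [YP YQ PQ]]] [v hv]; apply: PQ.
have dir P' : Y P' -> coords P' v.
  move=> YP'; have [x Px] := coords_ex P'.
  have [t xE] := hv x ((cone_coords Px).1 YP').
  have t0 : t != 0.
    by apply: contraNneq (coords_neq0 Px) => t0; rewrite xE t0 scale0r.
  by rewrite -(scalerK t0 v) -xE; apply: coordsZ; rewrite ?invr_eq0.
exact: coords_inj (dir P YP) (dir Q YQ).
Qed.

(** The eigenvalue at x is a quotient (x A)_j / x_j taking values among the
    roots of the characteristic polynomial; since the product of the forms
    (x A)_j - c x_j over these roots vanishes on X, one factor does. *)
Lemma cone_scalar (A : 'M[K]_N) :
  (forall x, X x -> exists t, x *m A = t *: x) ->
  exists c, forall x, X x -> x *m A = c *: x.
Proof.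
move=> hA; have [r rE] := closed_field_poly_normal (char_poly A).
have [y Xy /row_neq0[j yj]] := cone_point.
pose L i : {mpoly K[N]} := \sum_l A l i *: 'X_l.
have LE i (x : 'rV[K]_N) : (L i).@[x 0] = (x *m A) 0 i.
  rewrite mxE raddf_sum; apply: eq_bigr => l _.
  by rewrite /= mevalZ mevalXU mulrC.
have hL i : L i \is 1.-homog by apply: rpred_sum => l _; apply/rpredZ/homogXU.
have factor1 i c : (L i - c *: 'X_i) \is 1.-homog.
  by apply: rpredB => //; apply/rpredZ/homogXU.
have factor_homog i c : (L i - c *: 'X_i) \is homog mdeg.
  exact: homogE (factor1 i c).
have Xj_homog i : ('X_i : {mpoly K[N]}) \is homog mdeg.
  by apply/homogP; exists 1%N; apply: homogXU.
have Xj0 : ~ 'X_j = 0 %[on X].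
  by move=> /(_ y Xy)/eqP; rewrite mevalXU meval0 (negbTE yj).
have prod0 : \prod_(c <- r) (L j - c *: 'X_j) * 'X_j = 0 %[on X].
  move=> x Xx; rewrite meval0 mevalM mevalXU; have [->|xj] := eqVneq (x 0 j) 0.
    by rewrite mulr0.
  have [t xA] := hA x Xx; have x0 : x != 0.
    by apply: contraNneq xj => ->; rewrite mxE.
  have : root (char_poly A) t.
    by rewrite -eigenvalue_root_char; apply/eigenvalueP; exists x.
  rewrite rE (monicP (char_poly_monic A)) scale1r root_prod_XsubC => tr.
  rewrite (big_rem t tr) /= mevalM mevalB LE mevalZ mevalXU xA mxE subrr.
  by rewrite !mul0r.
have [c c0] : exists c, L j - c *: 'X_j = 0 %[on X].
  elim: r {rE} prod0 => [|c r IH].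
    by rewrite big_nil mul1r.
  rewrite big_cons -mulrA => /cone_prime[||h|/IH//]; first exact: factor_homog.
    apply/homogP; exists (size r + 1)%N; apply: dhomogM; last exact: homogXU.
    elim: r {IH} => [|c' r IH]; first by rewrite big_nil dhomog1.
    rewrite big_cons /= -add1n; exact: dhomogM (factor1 j c') IH.
  by exists c.
exists c => x Xx; apply/rowP => i; rewrite [RHS]mxE.
have : (L i - c *: 'X_i) * 'X_j = 0 %[on X].
  move=> z Xz; have := c0 z Xz; rewrite !(mevalM, mevalB, mevalZ, mevalXU, meval0) !LE.
  have [t ->] := hA z Xz; rewrite !mxE => h.
  have -> : (t * z 0 i - c * z 0 i) * z 0 j = (t * z 0 j - c * z 0 j) * z 0 i by ring.
  by rewrite h mul0r.
move=> /cone_prime[//||h|//]; first exact: Xj_homog.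
by apply/eqP; rewrite -subr_eq0 -LE -(mevalXU (x 0) i) -mevalZ -mevalB h // meval0.
Qed.

End Cone.

Section LinearExtension.
Variables (K : closedFieldType) (N : nat) (X : set 'rV[K]_N).

(** Rows chosen in X with the largest possible rank span X. *)
Lemma spanning_rows : exists r (B : 'M[K]_(r, N)),
  (forall i, X (row i B)) /\ forall x, X x -> (x <= B)%MS.
Proof.
pose ok k := exists r (B : 'M[K]_(r, N)), (forall i, X (row i B)) /\ \rank B = k.
have ex_ok : exists k, `[< ok k >].
  exists 0%N; apply/asboolP; exists 0%N, 0; split; last exact: mxrank0.
  by case.
have bound k : `[< ok k >] -> (k <= N)%N.
  by move=> /asboolP[r [B [_ <-]]]; apply: rank_leq_col.
case: (ex_maxnP ex_ok bound) => k /asboolP[r [B [XB rB]]] max.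
exists r, B; split=> // x Xx; apply: contraT => xB.
have lt : (B < col_mx B x)%MS.
  rewrite ltmxE; apply/andP; split; first by rewrite -addsmxE addsmxSl.
  by apply: contra xB; apply: submx_trans; rewrite -addsmxE addsmxSr.
have := max (\rank (col_mx B x)); rewrite leqNgt -rB rank_ltmx //= => h; apply: h.
apply/asboolP; exists (r + 1)%N, (col_mx B x); split=> // i.
rewrite -(splitK i); case: (split i) => l /=; first by rewrite rowKu.
rewrite rowKd (_ : row l x = x) //.
by apply/rowP => l'; rewrite mxE ord1.
Qed.

(** With P a projector onto the span of X, the matrix P A + (1 - P) acts as A on
    the span and as the identity on the complement; P A' + (1 - P) is its
    inverse. *)
Lemma linear_unit_extension (A A' : 'M[K]_N) :
  (forall x, X x -> X (x *m A)) -> (forall x, X x -> x *m A *m A' = x) ->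
  exists2 U, U \in unitmx & forall x, X x -> x *m U = x *m A.
Proof.
move=> XA AK; have [r [B [XB spanB]]] := spanning_rows.
pose P := pinvmx B *m B.
have PK x : X x -> x *m P = x by move=> /spanB xB; rewrite mulmxA mulmxKpV.
have BAA : B *m A *m A' = B.
  by apply/row_matrixP => i; rewrite !row_mul AK.
have BAP : B *m A *m P = B *m A.
  by apply/row_matrixP => i; rewrite !row_mul PK //; apply: XA.
have BP : B *m P = B by apply/row_matrixP => i; rewrite row_mul PK.
have PP : P *m P = P by rewrite {1}/P -mulmxA BP.
have PE (Z : 'M[K]_N) : P *m Z = pinvmx B *m (B *m Z) by rewrite mulmxA.
have PAA : P *m A *m A' = P by rewrite -mulmxA PE (mulmxA B) BAA.
have PAP : P *m A *m P = P *m A by rewrite -mulmxA !PE (mulmxA B) BAP.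
have UV : (P *m A + (1%:M - P)) *m (P *m A' + (1%:M - P)) = 1%:M.
  have PAC : P *m A *m (1%:M - P) = 0 by rewrite mulmxBr mulmx1 PAP subrr.
  have CPA : (1%:M - P) *m (P *m A') = 0.
    by rewrite mulmxA mulmxBl mul1mx PP subrr mul0mx.
  have CC : (1%:M - P) *m (1%:M - P) = 1%:M - P.
    by rewrite mulmxBr mulmx1 [X in _ - X]mulmxBl mul1mx PP subrr subr0.
  have expand (C : 'M[K]_N) : P *m A *m C = 0 -> C *m (P *m A') = 0 ->
      C *m C = C -> (P *m A + C) *m (P *m A' + C) = P + C.
    move=> PAC' CPA' CC'; rewrite mulmxDl !mulmxDr PAC' CPA' CC'.
    by rewrite mulmxA PAP PAA addr0 add0r.
  by rewrite expand // addrC subrK.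
exists (P *m A + (1%:M - P)); first by have [] := mulmx1_unit UV.
by move=> x Xx; rewrite mulmxDr mulmxBr mulmx1 mulmxA PK // subrr addr0.
Qed.

End LinearExtension.

(** * The automorphism groups *)

Section Automorphisms.
Variables (K : closedFieldType) (N : nat) (Y : set (pspace K N)).
Hypothesis Y_variety : projective_variety Y.
Local Notation X := (affine_cone Y).

Lemma linear_mapply (F : 'I_N -> {mpoly K[N]}) :
  (forall j, F j = pihomog mdeg 1 (F j) %[on X]) ->
  exists A : 'M[K]_N, forall x, X x -> mapply F x = x *m A.
Proof.
move=> Flin; pose P j := pihomog mdeg 1 (F j).
have hP j : P j \is 1.-homog by apply: pihomogP.
exists (\matrix_(i, j) ((P j)^`M(i))@_0) => x Xx; apply/rowP => j.
rewrite !mxE (Flin j x Xx) -/(P j) -[P j]scale1r -(euler_homog (hP j)).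
rewrite raddf_sum; apply: eq_bigr => i _ /=; rewrite mevalM mevalXU mxE mulrC.
by congr (_ * _); rewrite {1}(homog0_const (mderiv_homog i (hP j))) mevalC.
Qed.

Lemma affAut_of_matrix (A A' : 'M[K]_N) : A *m A' = 1%:M ->
  (forall x, X x -> X (x *m A)) -> (forall x, X x -> X (x *m A')) ->
  exists f : affAut X, forall x : X, val (f x) = val x *m A.
Proof.
move=> AA' XA XA'; have A'A := mulmx1C AA'.
pose map B (XB : forall x, X x -> X (x *m B)) (x : X) : X :=
  SigSub (mem_set (XB _ (set_valP x))).
have reg B XB : aregular (fun x => val (map B XB x)).
  exists (fun j => \sum_i B i j *: 'X_i) => x; apply/rowP => j; rewrite !mxE raddf_sum.
  by apply: eq_bigr => i _; rewrite /= mevalZ mevalXU mulrC.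
have can B B' XB XB' : B *m B' = 1%:M -> cancel (map B XB) (map B' XB').
  by move=> BB' x; apply: val_inj; rewrite /= -mulmxA BB' mulmx1.
by exists (@MkAut X (affine_regular_maps X) (map A XA) (map A' XA')
  (can _ _ _ _ AA') (can _ _ _ _ A'A) (reg A XA) (reg A' XA')).
Qed.

Lemma projAut_of_matrix (A A' : 'M[K]_N) : A *m A' = 1%:M ->
  (forall x, X x -> X (x *m A)) -> (forall x, X x -> X (x *m A')) ->
  exists g : projAut Y, forall (P : Y) x, coords (val P) x ->
    coords (val (g P)) (x *m A).
Proof.
have step (B B' : 'M[K]_N) : B *m B' = 1%:M -> (forall x, X x -> X (x *m B)) ->
    exists h : Y -> Y, forall P x, coords (val P) x -> coords (val (h P)) (x *m B).
  move=> BB' XB.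
  suff /choice[h hP] (P : Y) : exists Q : Y, forall x,
      coords (val P) x -> coords (val Q) (x *m B) by exists h.
  have [x Px] := coords_ex (val P).
  have Xx := (cone_coords Y_variety Px).1 (set_valP P).
  have xB0 : x *m B != 0.
    apply: contraNneq (coords_neq0 Px) => xB.
    by rewrite -[x]mulmx1 -BB' mulmxA xB mul0mx.
  have [Q YQ Qx] := cone_neq0 Y_variety (XB _ Xx) xB0.
  exists (SigSub (mem_set YQ)) => y Py; have [c c0 ->] := coords_prop Px Py.
  by rewrite -scalemxAl; apply: coordsZ.
move=> AA' XA XA'; have A'A := mulmx1C AA'.
have [h hP] := step A A' AA' XA; have [h' h'P] := step A' A A'A XA'.
have can B B' (k k' : Y -> Y) : B *m B' = 1%:M ->
    (forall P x, coords (val P) x -> coords (val (k P)) (x *m B)) ->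
    (forall P x, coords (val P) x -> coords (val (k' P)) (x *m B')) -> cancel k k'.
  move=> BB' kP k'P P; apply: val_inj; have [x Px] := coords_ex (val P).
  by apply: coords_inj (k'P _ _ (kP _ _ Px)) _; rewrite -mulmxA BB' mulmx1.
have reg B (k : Y -> Y) :
    (forall P x, coords (val P) x -> coords (val (k P)) (x *m B)) ->
    pregular (fun P => val (k P)).
  move=> kP P; exists 1, 1%N, (fun j => \sum_i B i j *: 'X_i); split.
  - by apply/homogP; exists 0%N; apply: dhomog1.
  - have [x Px] := coords_ex (val P); move=> /(_ x Px); rewrite meval1.
    by apply/eqP; apply: oner_neq0.
  - by move=> j; apply: rpred_sum => i _; apply/rpredZ/homogXU.
  - move=> Q x _ Qx; have := kP Q x Qx; congr coords; apply/rowP => j.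
    rewrite !mxE raddf_sum; apply: eq_bigr => i _.
    by rewrite /= mevalZ mevalXU mulrC.
by exists (@MkAut Y (projective_regular_maps Y) h h' (can _ _ _ _ AA' hP h'P)
  (can _ _ _ _ A'A h'P hP) (reg _ _ hP) (reg _ _ h'P)).
Qed.

Lemma affLin_inv (f : affAut X) (A : 'M[K]_N) : A \in unitmx ->
  (forall x : X, val (f x) = val x *m A) ->
  (forall x, X x -> X (x *m A)) /\ (forall x, X x -> X (x *m invmx A)).
Proof.
move=> uA fA; split=> x Xx.
  by have := fA (SigSub (mem_set Xx)) => <-; apply: set_valP.
have := fA (aut_inv f (SigSub (mem_set Xx))); rewrite aut_invK /= => ->.
by rewrite mulmxK //; apply: set_valP.
Qed.

Lemma extends_linearly_inv (g : projAut Y) (A : 'M[K]_N) : A \in unitmx ->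
  (forall (P : Y) x, coords (val P) x -> coords (val (g P)) (x *m A)) ->
  (forall x, X x -> X (x *m A)) /\ (forall x, X x -> X (x *m invmx A)).
Proof.
move=> uA gA; have X0 := cone0 Y_variety; split=> x Xx.
  have [->|x0] := eqVneq x 0; first by rewrite mul0mx.
  have [P YP Px] := cone_neq0 Y_variety Xx x0.
  by apply/(cone_coords Y_variety (gA (SigSub (mem_set YP)) x Px)); apply: set_valP.
have [->|x0] := eqVneq x 0; first by rewrite mul0mx.
have [P YP Px] := cone_neq0 Y_variety Xx x0; pose Q := aut_inv g (SigSub (mem_set YP)).
have [y Qy] := coords_ex (val Q); have := gA Q y Qy; rewrite /Q aut_invK => Py.
have [c c0 ->] := coords_prop Py Px.
rewrite -scalemxAl mulmxK //; apply: coneZ.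
by apply/(cone_coords Y_variety Qy); apply: set_valP.
Qed.

Section CentralExtension.
Hypothesis all_linear : forall f : affAut X, affLin X f.

Let point_of (P : Y) : exists x : X, coords (val P) (val x).
Proof.
have [x Px] := coords_ex (val P).
by exists (SigSub (mem_set ((cone_coords Y_variety Px).1 (set_valP P)))).
Qed.

(** The induced automorphism of Y is determined by its effect on coordinates, so
    the morphism property and surjectivity reduce to exhibiting automorphisms
    with the right effect. *)
Theorem central_extension_of_linear :
  exists (i : Kstar K -> affAut X) (p : affAut X -> projLin Y),
    [/\ central_extension i p,
        forall c (x : X), val (i c x) = val c *: val x
      & forall f (x : X) (P : Y),
          coords (val P) (val x) -> coords (val (val (p f) P)) (val (f x))].
Proof.
have /choice[i iE] (c : Kstar K) : exists f : affAut X,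
    forall x : X, val (f x) = val c *: val x.
  have cc' : (val c)%:M *m (val c)^-1%:M = 1%:M :> 'M[K]_N.
    by rewrite -scalar_mxM mulfV // (valP c).
  case: (affAut_of_matrix cc') => [x Xx|x Xx|f fE];
    try by rewrite mul_mx_scalar; apply: coneZ.
  by exists f => x; rewrite fE mul_mx_scalar.
have /choice[p pE] (f : affAut X) : exists g : projLin Y, forall (x : X) (P : Y),
    coords (val P) (val x) -> coords (val (val g P)) (val (f x)).
  have [A [uA fA]] := all_linear f; have [XA XA'] := affLin_inv uA fA.
  have [g gE] := projAut_of_matrix (mulmxV uA) XA XA'.
  have gL : g \in projLin_pred (Y := Y) by apply/asboolP; exists A.
  by exists (exist _ g gL) => x P Px; rewrite fA; apply: gE.
have p_unique (f : affAut X) (g : projLin Y) : (forall (x : X) (P : Y), coords (val P) (val x) ->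
    coords (val (val g P)) (val (f x))) -> p f = g.
  move=> gE; apply: val_inj; apply: aut_ext => P; apply: val_inj.
  have [x Px] := point_of P; exact: coords_inj (pE f x P Px) (gE x P Px).
have [y0 Xy0 y0_neq0] := cone_point Y_variety.
pose y : X := SigSub (mem_set Xy0).
exists i, p; split=> //; split; first split.
- move=> a b; apply: aut_ext => x; apply: val_inj.
  by rewrite iE /= !iE scalerA.
- move=> e f; apply: p_unique => x P Px /=.
  by apply: (pE e); apply: pE.
split.
- move=> a b iab; apply: val_inj; have := iE a y; rewrite iab iE => /eqP.
  rewrite -subr_eq0 -scalerBl scaler_eq0 (negbTE y0_neq0) orbF subr_eq0.
  by move=> /eqP.
- move=> g; have /asboolP[A [uA gA]] := valP g.
  have [XA XA'] := extends_linearly_inv uA gA.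
  have [e eE] := affAut_of_matrix (mulmxV uA) XA XA'.
  by exists e; apply: p_unique => x P Px; rewrite eE; apply: gA.
- move=> e; split=> [pe1|[a ->]]; last first.
    apply: p_unique => x P Px; rewrite iE /=; apply: coordsZ => //; exact: (valP a).
  have [A [uA eA]] := all_linear e.
  have eigen x : X x -> exists t, x *m A = t *: x.
    move=> Xx; have [->|x0] := eqVneq x 0; first by exists 0; rewrite mul0mx scaler0.
    have [P YP Px] := cone_neq0 Y_variety Xx x0.
    have := pE e (SigSub (mem_set Xx)) (SigSub (mem_set YP)) Px.
    rewrite pe1 eA /= => Pe; have [t _ ->] := coords_prop Px Pe; by exists t.
  have [c cE] := cone_scalar Y_variety eigen.
  have c0 : c != 0.
    apply: contraNneq y0_neq0 => c0; have := cE _ Xy0; rewrite c0 scale0r => yA.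
    by rewrite -[y0](mulmxK uA) yA mul0mx.
  exists (exist _ c c0); apply: aut_ext => x; apply: val_inj.
  by rewrite iE eA cE //; apply: set_valP.
- move=> a e; apply: aut_ext => x; apply: val_inj; have [A [_ eA]] := all_linear e.
  by rewrite /= iE !eA iE scalemxAl.
Qed.

End CentralExtension.

Hypothesis char0 : forall m, m.+1%:R != 0 :> K.
Hypothesis Y_points : exists P Q, [/\ Y P, Y Q & P <> Q].

Theorem affAut_linear_or_ruling (f : affAut X) :
  (exists _ : ruling X, True) \/ affLin X f.
Proof.
have [F fF] := aut_funP f; have [F' fF'] := aut_invP f.
have FE (x : X) : mapply F (val x) = val (f x) by rewrite fF.
have F'E (x : X) : mapply F' (val x) = val (aut_inv f x) by rewrite fF'.
have FX x : X x -> X (mapply F x).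
  by move=> Xx; have := FE (SigSub (mem_set Xx)) => /= ->; apply: set_valP.
have F'X x : X x -> X (mapply F' x).
  by move=> Xx; have := F'E (SigSub (mem_set Xx)) => /= ->; apply: set_valP.
have FK x : X x -> mapply F' (mapply F x) = x.
  move=> Xx; have := FE (SigSub (mem_set Xx)) => /= ->.
  by rewrite F'E aut_funK.
have F'K x : X x -> mapply F (mapply F' x) = x.
  move=> Xx; have := F'E (SigSub (mem_set Xx)) => /= ->.
  by rewrite FE aut_invK.
have coneX := @coneZ _ _ Y; have primeX := cone_prime Y_variety.
have not_line := cone_not_line Y_variety Y_points.
have [|Flin] := ruling_or_linear char0 coneX primeX not_line FX F'X FK F'K.
  by left.
have [|F'lin] := ruling_or_linear char0 coneX primeX not_line F'X FX F'K FK.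
  by left.
have [[A AE] [A' A'E]] := (linear_mapply Flin, linear_mapply F'lin).
right; have [||U uU UE] := @linear_unit_extension _ _ X A A'.
- by move=> x Xx; rewrite -AE //; apply: FX.
- by move=> x Xx; rewrite -AE // -A'E ?FK //; apply: FX.
by exists U; split=> // x; rewrite -FE AE ?UE //; apply: set_valP.
Qed.

End Automorphisms.

Lemma ruled_of_ruling (K : closedFieldType) n (Y : set (pspace K n.+1)) :
  projective_variety Y -> (exists _ : ruling (affine_cone Y), True) ->
  birationally_ruled Y.
Proof.
move=> Yvar [rl _]; have [Z [Zvar YZ]] := ruling_birational Yvar.1
  (cone_coords Yvar) (cone_prime Yvar) rl.
by exists (bdeg rl + n * (bdeg rl).+1)%N, Z.
Qed.

Theorem corollary2p4 (R : realType) (n : nat) (Y : set (pspace R[i] n.+1))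
    (Yvar : projective_variety Y) (Ysmooth : smooth Y)
    (Ypos : exists P Q, [/\ Y P, Y Q & P <> Q])
    (Ynruled : ~ birationally_ruled Y) :
  affLin (affine_cone Y) = [set: affAut (affine_cone Y)] /\
  exists (i : Kstar R[i] -> affAut (affine_cone Y))
         (p : affAut (affine_cone Y) -> projLin Y),
    [/\ central_extension i p,
        forall c (x : affine_cone Y), val (i c x) = val c *: val x
      & forall f (x : affine_cone Y) (P : Y),
          coords (val P) (val x) -> coords (val (val (p f) P)) (val (f x))].
Proof.
have char0 m : m.+1%:R != 0 :> R[i] by rewrite pnatr_eq0.
have linear f : affLin (affine_cone Y) f.
  have [rl|//] := affAut_linear_or_ruling Yvar char0 Ypos f.
  by case: Ynruled; apply: ruled_of_ruling.
split; first by apply/seteqP; split.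
exact: central_extension_of_linear.
Qed.
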